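(* Let $\{\mathcal{W}_i\}_{i\in\mathbb{N}}$ be a collection of independent simple random walks on $\mathbb{Z}^2$, each viewed as an infinite word whose letters are chosen independently and uniformly at random from $\{\mathbf{x},-\mathbf{x},\mathbf{y},-\mathbf{y}\}$, where $\mathbf{x}=(1,0)$ and $\mathbf{y}=(0,1)$. Then, almost surely, there exists a (random, i.e. depending on the whole collection $\{\mathcal{W}_i\}_{i\in\mathbb{N}}$) spanning subgraph $H\subset\mathbb{Z}^2$ such that, for every $i\in\mathbb{N}$, the induced walk $(\mathcal{W}_i)_H$ (1) visits each site reachable from the origin in $H$ only finitely many times, and (2) fails to visit infinitely many sites reachable from the origin in $H$ (that is, the set of sites reachable from the origin in $H$ that are never visited by $(\mathcal{W}_i)_H$ is infinite).
   Context: $\mathbb{Z}^2$ denotes the square lattice, regarded as a graph with vertex set $\mathbb{Z}^2$ and edges between points at Euclidean distance $1$. A spanning subgraph $G\subset\mathbb{Z}^2$ has vertex set all of $\mathbb{Z}^2$ and an arbitrary subset of the edges of the lattice. Induced walk: given an infinite word $\mathcal{W}=w_1w_2w_3\cdots$ on the alphabet $\{\mathbf{x},-\mathbf{x},\mathbf{y},-\mathbf{y}\}$ and a spanning subgraph $G\subset\mathbb{Z}^2$, the induced walk $\mathcal{W}_G$ on $G$ starts at the origin, and reads the letters of $\mathcal{W}$ one at a time: if the walk is at $v$ and the next letter is $w$, then it moves to $v+w$ if the edge $\{v,v+w\}$ is present in $G$, and stands still at $v$ otherwise. A site is reachable from the origin in $G$ if it lies in the connected component of the origin in $G$. *)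

(* Defs.v *)
From HB Require Import structures.
From mathcomp Require Import all_boot all_order all_algebra finmap.
From mathcomp Require Import all_classical all_reals all_analysis.

Set Implicit Arguments.
Unset Strict Implicit.
Unset Printing Implicit Defensive.

Import Order.TTheory GRing.Theory Num.Theory.

Local Open Scope classical_set_scope.
Local Open Scope ring_scope.

Definition site : Type := (int * int)%type.

Definition origin : site := (0, 0).

Definition lattice_edge : rel site :=
  [rel u v | (u.1 - v.1) ^+ 2 + (u.2 - v.2) ^+ 2 == 1].

(* A spanning subgraph of the square lattice is given by its adjacency
   relation; its vertex set is all of [site]. *)
Definition spanning_subgraph (H : rel site) : Prop :=
  symmetric H /\ subrel H lattice_edge.

Definition reachable (H : rel site) (v : site) : Prop :=
  exists p : seq site, path H origin p /\ last origin p = v.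

Inductive letter : Set := PosX | NegX | PosY | NegY.

Definition letter_vec (a : letter) : site :=
  match a with
  | PosX => (1, 0)
  | NegX => (- 1, 0)
  | PosY => (0, 1)
  | NegY => (0, - 1)
  end.

Definition pair_of_letter (a : letter) : bool * bool :=
  match a with
  | PosX => (true, true)
  | NegX => (true, false)
  | PosY => (false, true)
  | NegY => (false, false)
  end.

Definition letter_of_pair (b : bool * bool) : letter :=
  match b with
  | (true, true) => PosX
  | (true, false) => NegX
  | (false, true) => PosY
  | (false, false) => NegY
  end.

Lemma pair_of_letterK : cancel pair_of_letter letter_of_pair.
Proof. by case. Qed.

HB.instance Definition _ := Finite.copy letter (can_type pair_of_letterK).
HB.instance Definition _ := isPointed.Build letter PosX.
HB.instance Definition _ := @isMeasurable.Build default_measure_display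
  letter discrete_measurable discrete_measurable0
  discrete_measurableC discrete_measurableU.

Definition word : Type := nat -> letter.

(* [w n] is the letter w_{n+1}; [induced_walk w H n] is the position after
   reading the first [n] letters. *)
Fixpoint induced_walk (w : word) (H : rel site) (n : nat) : site :=
  match n with
  | 0%N => origin
  | n'.+1 =>
      let v := induced_walk w H n' in
      let v' := v + letter_vec (w n') in
      if H v v' then v' else v
  end.

Definition visits (w : word) (H : rel site) (v : site) : set nat :=
  [set n | induced_walk w H n = v].

(* Mutual independence of a family of classes of events; a family of random
   variables is independent when the sigma-algebras they generate are. *)
Definition independent d (T : measurableType d) (R : realType)
    (P : probability T R) (I : choiceType) (F : I -> set (set T)) : Prop :=
  forall (J : {fset I}) (A : I -> set T), (forall j, j \in J -> F j (A j)) ->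
    P (\bigcap_(j in [set` J]) A j) = (\prod_(j <- J) P (A j))%E.

Definition simple_random_walk d (T : measurableType d) (R : realType)
    (P : probability T R) (w : nat -> {RV P >-> letter}) : Prop :=
  independent P (fun n => g_sigma_algebra_preimage (w n)) /\
  forall (n : nat) (a : letter), distribution P (w n) [set a] = (4^-1)%:E.

(* The pullback, along t |-> (n |-> w n t), of the product sigma-algebra on
   [word]. *)
Definition word_sigma_algebra d (T : measurableType d) (R : realType)
    (P : probability T R) (w : nat -> {RV P >-> letter}) : set (set T) :=
  <<s \bigcup_n g_sigma_algebra_preimage (w n) >>.

(* Main.v *)
Require Import Defs.
From HB Require Import structures.
From mathcomp Require Import all_boot all_order all_algebra finmap.
From mathcomp Require Import all_classical all_reals all_analysis.
From mathcomp Require Import zify ring lra.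

Set Implicit Arguments.
Unset Strict Implicit.
Unset Printing Implicit Defensive.

Import Order.TTheory GRing.Theory Num.Theory.

Local Open Scope classical_set_scope.
Local Open Scope ring_scope.

(** Why the theorem is true.

    The graph [H] is built by an exploration that reads the words letter by
    letter and never reads a letter twice.  However adaptively it chooses the
    word to read next, what it reads is a sequence of independent uniform
    letters.  It depends on a parameter [K] and goes wrong with probability at
    most [3 / 2 ^ K] ([prob_ever_lost]); hence almost surely it goes right for
    some [K], and it is enough to extract [H] from an exploration that goes
    right.

    [H] is an increasing union of finite trees rooted at the origin, with all
    edges directed to the right or upwards.  There is a trunk, the vertical
    half-axis; walker [w] has its own lane, which leaves the trunk at height
    [anchor w], and the lanes are disjoint.  In its lane the walker is offered
    a sequence of combs: a vertical spine with [teeth s] horizontal teeth, all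
    ending in the column [column s.+1], where [column s.+1 = teeth s ^ 2].
    During the stage [(s, w)] only walker [w] moves, on the finite tree built
    so far together with a new comb attached to its current tip, until it
    reaches the far end of some tooth.  That end, which depends on the letters
    just read, is its new tip; the ends of the other teeth stay dead ends
    forever.

    This choice among the teeth is what beats recurrence.  Seen from its root,
    a comb with [r] teeth of length [r ^ 2] has effective resistance of order
    [r], whereas the part of the tree behind the tip has resistance of order
    [column s], which is much larger than [r].  So the walker advances by
    [r ^ 2] before it retreats by a fixed fraction of its depth, except with a
    probability of order [r / column s], and these probabilities have a small
    sum.  A walker that starts at the origin likewise reaches its own first
    comb before the tips of the others, because these are already very deep.

    The estimate is carried by one potential, [gauge].  For vertices [t], [v]
    of a tree let [common t v] be the number of common vertices of the paths
    from the root to [t] and to [v].  As a function of [v] it is harmonic away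
    from [t] and from the root ([common_drift]), so sums of such functions,
    over the ends of the teeth and over the tips of the other walkers, bound
    the probability of a bad exit ([risk]).  Adding a multiple of the elapsed
    time ([delay]) and the budget of the later stages ([reserve]) makes
    [gauge] a nonnegative supermartingale ([gauge_drift]) with a small initial
    value ([gauge0]), and an exploration has gone wrong when [gauge] reaches
    [1].

    Suppose that this never happens.  Then every stage ends, because [delay]
    bounds its duration ([leave_stage]).  No walker ever stands on a site
    where edges may still be added, so it moves as it does on [H]
    ([walk_run]).  At the levels [s > w] walker [w] stays at depth more than
    [2 * anchor s], so that it visits every site finitely often
    ([finite_visits]), and it never visits the sites of the trunk where the
    walkers [q >= w + 2] branch off ([infinitely_many_missed]). *)

(** * Finite rooted trees in the lattice *)

(** A tree is the list of its edges (child, parent), the last one added at the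
    head; the root is [origin]. *)
Definition tree := seq (site * site).

Definition verts (l : tree) : seq site := origin :: unzip1 l.

(** The vertices from [v] down to the root, and [[::]] when [v] is not a
    vertex. *)
Fixpoint tpath (l : tree) (v : site) : seq site :=
  if l is cp :: l' then
    if v == cp.1 then v :: tpath l' cp.2 else tpath l' v
  else if v == origin then [:: origin] else [::].

(** Since all edges go right or up, the depth of a vertex is determined by its
    coordinates ([size_tpath]): no path length ever has to be computed. *)
Definition up_step (p c : site) : bool :=
  (c == p + letter_vec PosX) || (c == p + letter_vec PosY).

Fixpoint wf (l : tree) : bool :=
  if l is cp :: l' then
    [&& wf l', cp.1 \notin verts l', cp.2 \in verts l' & up_step cp.2 cp.1]
  else true.

Definition edge (l : tree) (u v : site) : bool :=
  ((u, v) \in l) || ((v, u) \in l).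

Definition step (l : tree) (v : site) (a : letter) : site :=
  let v' := v + letter_vec a in if edge l v v' then v' else v.

Lemma sumXY (v : site) a : (v + letter_vec a).1 + (v + letter_vec a).2 =
  v.1 + v.2 + (if a is (PosX | PosY) then 1 else -1).
Proof. by case: v a => x y [] /=; ring. Qed.

Lemma up_step_sum p c : up_step p c -> c.1 + c.2 = p.1 + p.2 + 1.
Proof. by case/orP=> /eqP ->; rewrite sumXY. Qed.

Lemma mem_verts_child (l : tree) c p : (c, p) \in l -> c \in verts l.
Proof. by move=> h; rewrite inE; apply/orP; right; apply/mapP; exists (c, p). Qed.

Lemma verts_cons cp (l : tree) v :
  (v \in verts (cp :: l)) = (v == cp.1) || (v \in verts l).
Proof. by rewrite !inE orbCA. Qed.

Lemma vertsP (l : tree) v :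
  reflect (v = origin \/ exists p, (v, p) \in l) (v \in verts l).
Proof.
rewrite inE; apply: (iffP orP) => [[/eqP|/mapP[[c p] h /= ->]]|[->|[p h]]].
- by left.
- by right; exists p.
- by left.
- by right; apply/mapP; exists (v, p).
Qed.

Section WellFormed.
Context {l : tree} (wfl : wf l).

Lemma wf_edge c p : (c, p) \in l -> (p \in verts l) && up_step p c.
Proof.
elim: l wfl c p => //= -[c0 p0] l' IH /and4P[w n m u] c p.
rewrite inE verts_cons => /orP[/eqP[-> ->]|h]; first by rewrite m u orbT.
by case/andP: (IH w _ _ h) => -> ->; rewrite orbT.
Qed.

Lemma wf_parent_mem c p : (c, p) \in l -> p \in verts l.
Proof. by case/wf_edge/andP. Qed.

Lemma wf_up c p : (c, p) \in l -> up_step p c.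
Proof. by case/wf_edge/andP. Qed.

End WellFormed.

Lemma tpath_child l c p : wf l -> (c, p) \in l -> tpath l c = c :: tpath l p.
Proof.
elim: l c p => //= -[c0 p0] l' IH c p /= /and4P[w n m u].
have neq v : v \in verts l' -> (v == c0) = false.
  by move=> h; apply: contraNF n => /eqP <-.
rewrite inE => /orP[/eqP[-> ->]|h]; first by rewrite eqxx neq.
rewrite (neq _ (mem_verts_child h)) (neq _ (wf_parent_mem w h)).
exact: IH.
Qed.

Lemma wf_origin l p : wf l -> (origin, p) \notin l.
Proof.
elim: l => //= -[c0 p0] l' IH /and4P[w n _ _].
rewrite inE negb_or IH // andbT; apply: contra n => /eqP[<- _].
by rewrite inE eqxx.
Qed.

Lemma tpath_origin l : wf l -> tpath l origin = [:: origin].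
Proof.
elim: l => [|[c p] l' IH] //= /and4P[w n _ _].
by rewrite ifN ?IH //; apply: contra n => /eqP <-; rewrite inE eqxx.
Qed.

Lemma tpath_head l v : wf l -> v \in verts l ->
  exists s, tpath l v = v :: s.
Proof.
move=> w /vertsP[->|[p h]]; first by exists [::]; rewrite tpath_origin.
by exists (tpath l p); rewrite (tpath_child w h).
Qed.

Lemma mem_tpath l v : wf l -> v \in verts l -> v \in tpath l v.
Proof. by move=> w h; have [s ->] := tpath_head w h; rewrite inE eqxx. Qed.

Lemma wf_parent_uniq l c p p' : wf l -> (c, p) \in l -> (c, p') \in l -> p = p'.
Proof.
move=> w h h'; have := tpath_child w h; rewrite (tpath_child w h') => -[e].
have [s es] := tpath_head w (wf_parent_mem w h).
have [s' es'] := tpath_head w (wf_parent_mem w h').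
by move: e; rewrite es es' => -[].
Qed.

(** Induction from the root along the edges. *)
Lemma tpath_ind l (Q : site -> Prop) : wf l ->
  Q origin -> (forall c p, (c, p) \in l -> Q p -> Q c) ->
  forall v, v \in verts l -> Q v.
Proof.
move=> w Q0 Qc; elim: l w Qc => [|[c p] l IH] w Qc v.
  by rewrite !inE => /eqP ->.
case/and4P: w => w n m u; have {}IH : forall v, v \in verts l -> Q v.
    by apply: IH => // c' p' h; apply: Qc; rewrite inE h orbT.
rewrite verts_cons => /orP[/eqP ->|]; last exact: IH.
by apply: (Qc _ p); [rewrite inE eqxx | apply: IH].
Qed.

Lemma size_tpath l v : wf l -> v \in verts l ->
  (size (tpath l v))%:Z = v.1 + v.2 + 1.
Proof.
move=> w; move: v; apply: tpath_ind => //; first by rewrite tpath_origin.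
move=> c p h IH; rewrite (tpath_child w h) /= (up_step_sum (wf_up w h)).
by rewrite -addn1 PoszD IH.
Qed.

Lemma tpath_sub l u v : wf l -> v \in verts l -> u \in tpath l v -> u \in verts l.
Proof.
move=> w; move: v; apply: tpath_ind => //.
  by rewrite tpath_origin // inE => /eqP ->; rewrite inE eqxx.
move=> c p h IH; rewrite (tpath_child w h) inE => /orP[/eqP ->|//].
exact: mem_verts_child h.
Qed.

Lemma tpath_cat l u v : wf l -> v \in verts l -> u \in tpath l v ->
  exists s, tpath l v = s ++ tpath l u.
Proof.
move=> w; move: v; apply: tpath_ind => //.
  by rewrite tpath_origin // inE => /eqP ->; exists [::]; rewrite tpath_origin.
move=> c p h IH; rewrite (tpath_child w h) inE => /orP[/eqP ->|/IH[s ->]].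
  by exists [::]; rewrite (tpath_child w h).
by exists (c :: s).
Qed.

Lemma tpath_trans l u v x : wf l -> x \in verts l ->
  u \in tpath l v -> v \in tpath l x -> u \in tpath l x.
Proof.
by move=> w xV uv /(tpath_cat w xV)[s ->]; rewrite mem_cat uv orbT.
Qed.

Lemma tpath_on_origin l v : wf l -> v \in verts l -> origin \in tpath l v.
Proof.
move=> w; move: v; apply: tpath_ind => //; first by rewrite tpath_origin // inE.
by move=> c p h IH; rewrite (tpath_child w h) inE IH orbT.
Qed.

Lemma child_towards l t v : wf l -> t \in verts l -> v \in tpath l t -> v != t ->
  exists2 c, (c, v) \in l & c \in tpath l t.
Proof.
move=> w; move: t; apply: tpath_ind => //.
  by rewrite tpath_origin // inE => /eqP ->; rewrite eqxx.
move=> c p h IH; rewrite (tpath_child w h) inE => /orP[/eqP ->|vp].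
  by rewrite eqxx.
move=> _; have [->|np] := eqVneq v p; first by exists c; rewrite // inE eqxx.
by have [c' h1 h2] := IH vp np; exists c'; rewrite // inE h2 orbT.
Qed.

(** Both children have the same depth, and a path to the root meets each depth
    once. *)
Lemma child_towards_uniq l t v c c' : wf l -> t \in verts l ->
  (c, v) \in l -> (c', v) \in l -> c \in tpath l t -> c' \in tpath l t -> c = c'.
Proof.
move=> w tV h h' ct c't.
have [s e] := tpath_cat w tV ct; have [s' e'] := tpath_cat w tV c't.
rewrite (tpath_child w h) in e; rewrite (tpath_child w h') in e'.
have ss : size s = size s'.
  have := congr1 size e; rewrite e' !size_cat /=; lia.
by move/eqP: e; rewrite e' eqseq_cat // => /andP[_ /eqP[->]].
Qed.

(** The depth of the last common ancestor of [t] and [v].  Up to an affine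
    change this is the voltage at [v] when a unit current flows from the root
    to [t], all edges having resistance 1. *)
Definition common (l : tree) (t v : site) : nat :=
  count (mem (tpath l t)) (tpath l v).

Lemma common_child l t c p : wf l -> (c, p) \in l ->
  common l t c = ((c \in tpath l t) + common l t p)%N.
Proof. by move=> w h; rewrite /common (tpath_child w h). Qed.

Lemma common_origin l t : wf l -> t \in verts l -> common l t origin = 1%N.
Proof. by move=> w tV; rewrite /common tpath_origin //= tpath_on_origin. Qed.

Lemma common_anc l t e : wf l -> t \in verts l -> e \in tpath l t ->
  common l t e = size (tpath l e).
Proof.
move=> w tV et; apply/eqP; rewrite -all_count; apply/allP => x xe.
exact: (tpath_trans w tV xe et).
Qed.

Lemma common_le l t v : (common l t v <= size (tpath l v))%N.
Proof. exact: count_size. Qed.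

Lemma letter_vec_inj : injective letter_vec.
Proof. by case; case. Qed.

Lemma up_step_letter p c : up_step p c ->
  (exists a, c = p + letter_vec a) /\ (exists a, p = c + letter_vec a).
Proof.
case/orP=> /eqP ->; split.
- by exists PosX.
- by exists NegX; rewrite -addrA [X in _ + X](_ : _ = 0) ?addr0.
- by exists PosY.
- by exists NegY; rewrite -addrA [X in _ + X](_ : _ = 0) ?addr0.
Qed.

Lemma sum_letter1 (R : pzSemiRingType) (Q : pred letter) a0 :
  Q a0 -> (forall a, Q a -> a = a0) -> \sum_a (Q a)%:R = 1 :> R.
Proof.
move=> Qa u; rewrite (bigD1 a0) //= Qa big1 ?addr0 // => a na.
by case: (boolP (Q a)) => // /u /eqP; rewrite (negbTE na).
Qed.

Lemma sum_letter0 (R : pzSemiRingType) (Q : pred letter) :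
  (forall a, ~~ Q a) -> \sum_a (Q a)%:R = 0 :> R.
Proof. by move=> h; rewrite big1 // => a _; rewrite (negbTE (h a)). Qed.

Lemma card_letter : #|{: letter}| = 4%N.
Proof.
have -> : 4%N = #|{: bool * bool}| by rewrite card_prod card_bool.
apply: (bij_eq_card (f := pair_of_letter)).
by exists letter_of_pair => [|[[] []]]; first exact: pair_of_letterK.
Qed.

Lemma edge_asym l u v : wf l -> (u, v) \in l -> (v, u) \in l -> False.
Proof.
move=> w /(wf_up w)/up_step_sum h /(wf_up w)/up_step_sum; lia.
Qed.

Lemma common_step (R : comPzRingType) l t v a : wf l ->
  (common l t (step l v a))%:R = (common l t v)%:R
   + (((v + letter_vec a, v) \in l) && (v + letter_vec a \in tpath l t))%:R
   - ((v, v + letter_vec a) \in l)%:R * (v \in tpath l t)%:R :> R.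
Proof.
move=> w; rewrite /step /edge; set v' := v + _.
have [h|nh] := boolP ((v, v') \in l).
  have /negbTE -> /= : (v', v) \notin l by apply/negP => /(edge_asym w h).
  rewrite (common_child t w h) natrD; ring.
have [h|nh'] := boolP ((v', v) \in l); last by rewrite /= addr0 mul0r subr0.
by rewrite /= (common_child t w h) natrD mul0r subr0 addrC.
Qed.

(** Moving from [v], [common l t] changes only along the path to [t], where it
    goes up by 1 towards [t] and down by 1 towards the root.  The root has no
    parent, which is the only source of drift as long as [v != t]. *)
Lemma common_drift (R : comPzRingType) l t v : wf l -> t \in verts l ->
  v \in verts l -> v != t ->
  \sum_a (common l t (step l v a))%:R
    = (common l t v)%:R *+ 4 + (v == origin)%:R :> R.
Proof.
move=> w tV vV nt.
under eq_bigr do rewrite common_step //.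
rewrite sumrB big_split /= sumr_const card_letter -addrA; congr (_ + _).
rewrite -mulr_suml.
have -> : \sum_a ((v, v + letter_vec a) \in l)%:R = (v != origin)%:R :> R.
  have [->|no] := eqVneq v origin.
    by apply: sum_letter0 => a; apply: wf_origin.
  case/vertsP: vV => [/eqP|[p h]]; first by rewrite (negbTE no).
  have [_ [a ea]] := up_step_letter (wf_up w h).
  apply: (@sum_letter1 _ _ a) => [|b hb]; first by rewrite -ea.
  by have := wf_parent_uniq w h hb; rewrite ea => /addrI/letter_vec_inj.
have [vt|vt] := boolP (v \in tpath l t).
  have [c h ct] := child_towards w tV vt nt.
  have [[a ea] _] := up_step_letter (wf_up w h).
  rewrite (@sum_letter1 _ _ a) => [||b /andP[hb bt]]; last first.
  - have := child_towards_uniq w tV h hb ct bt.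
    by rewrite ea => /addrI/letter_vec_inj.
  - by rewrite -ea h ct.
  by rewrite mulr1; case: (v == origin); rewrite /= ?subr0 ?subrr.
rewrite sum_letter0 => [|a]; last first.
  apply/negP => /andP[h ct]; case/negP: vt; apply: (tpath_trans w tV _ ct).
  by rewrite (tpath_child w h) inE mem_tpath ?orbT // (wf_parent_mem w h).
have /negbTE -> : v != origin.
  by apply: contraNneq vt => ->; apply: tpath_on_origin.
by rewrite mulr0 subrr.
Qed.

Lemma step_verts l v a : wf l -> v \in verts l -> step l v a \in verts l.
Proof.
rewrite /step /edge /= => w vV; case: ifP => // /orP[h|h].
  exact: (wf_parent_mem w h).
exact: mem_verts_child h.
Qed.

(** Up to a constant, minus the distance from [v] to [t]: this distance is
    [size (tpath l v) + size (tpath l t) - 2 * common l t v]. *)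
Definition nearness (l : tree) (t : site) (D : nat) (v : site) : nat :=
  (D + (common l t v).*2 - size (tpath l v))%N.

(** A potential for the time needed to reach [t]: with probability at least 1/4 the
    next letter brings the walk nearer to [t], and the basis 5 is large enough
    for this to outweigh the other three letters. *)
Definition lag (l : tree) (t : site) (D : nat) (v : site) : nat :=
  (5 ^ (D.*2) - 5 ^ nearness l t D v)%N.

Lemma step_nearer l t D v : wf l -> t \in verts l -> v \in verts l -> v != t ->
  (size (tpath l v) <= D)%N ->
  exists a, nearness l t D (step l v a) = (nearness l t D v).+1.
Proof.
move=> w tV vV nt sD; rewrite /nearness.
have [vt|vt] := boolP (v \in tpath l t).
  have [c h ct] := child_towards w tV vt nt.
  have [[a ea] _] := up_step_letter (wf_up w h).
  exists a; rewrite /step /edge -ea h orbT.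
  by rewrite (common_child t w h) ct (tpath_child w h) /=; lia.
case/vertsP: (vV) => [e|[p h]].
  by move: vt; rewrite e tpath_on_origin.
have [_ [a ea]] := up_step_letter (wf_up w h).
exists a; rewrite /step /edge -ea h /=.
rewrite (common_child t w h) (negbTE vt) /= add0n.
by move: sD; rewrite (tpath_child w h) /=; lia.
Qed.

Lemma lag_drift l t D v : wf l -> t \in verts l -> v \in verts l -> v != t ->
  (forall u, u \in verts l -> size (tpath l u) <= D)%N ->
  (\sum_a lag l t D (step l v a) + 1 <= 4 * lag l t D v)%N.
Proof.
move=> w tV vV nt sD.
have [a0 ha0] := step_nearer w tV vV nt (sD v vV).
(* The letter [a0] multiplies the term that is subtracted in [lag] by 5; for
   the other three letters only [lag <= 5 ^ D.*2] is used. *)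
have le2 u : u \in verts l -> (5 ^ nearness l t D u <= 5 ^ D.*2)%N.
  move=> uV; apply: leq_pexp2l => //; rewrite /nearness.
  by have := sD u uV; have := common_le l t u; lia.
have h0 := le2 _ (step_verts a0 w vV).
rewrite (bigD1 a0) //=.
have hs : (\sum_(a | a != a0) lag l t D (step l v a) <= 3 * 5 ^ D.*2)%N.
  apply: (@leq_trans (\sum_(a : letter | a != a0) 5 ^ D.*2)%N).
    by apply: leq_sum => a _; rewrite leq_subr.
  rewrite sum_nat_const leq_mul2r; apply/orP; right.
  by rewrite (cardC1 a0) card_letter.
move: h0 hs; rewrite /lag ha0 expnS => h0 hs.
have : (0 < 5 ^ nearness l t D v)%N by rewrite expn_gt0.
move: (\sum_(_ | _) _)%N hs h0 => S; lia.
Qed.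

(** * Adding branches to a tree *)
Definition grow (l : tree) (es : seq (site * site)) : tree := catrev es l.

Lemma mem_grow l es e : (e \in grow l es) = (e \in es) || (e \in l).
Proof. by rewrite /grow catrevE mem_cat mem_rev. Qed.

Lemma verts_grow l es v :
  (v \in verts (grow l es)) = (v \in unzip1 es) || (v \in verts l).
Proof.
by rewrite !inE /grow catrevE /unzip1 map_cat mem_cat map_rev mem_rev orbCA.
Qed.

Lemma grow_cat l es es' : grow l (es ++ es') = grow (grow l es) es'.
Proof. by rewrite /grow !catrevE rev_cat catA. Qed.

Lemma wf_cons cp l : wf (cp :: l) =
  [&& wf l, cp.1 \notin verts l, cp.2 \in verts l & up_step cp.2 cp.1].
Proof. by []. Qed.

Definition segment (f : nat -> site) (n : nat) : seq (site * site) :=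
  [seq (f i.+1, f i) | i <- iota 0 n].

Lemma segmentP f n (e : site * site) :
  reflect (exists2 i, (i < n)%N & e = (f i.+1, f i)) (e \in segment f n).
Proof.
apply: (iffP mapP) => -[i]; rewrite ?mem_iota => h ->; exists i => //.
by rewrite mem_iota.
Qed.

Lemma segment_childP f n v :
  reflect (exists2 i, (i < n)%N & v = f i.+1) (v \in unzip1 (segment f n)).
Proof.
apply: (iffP mapP) => [[e /segmentP[i h ->] ->]|[i h ->]]; first by exists i.
by exists (f i.+1, f i) => //; apply/segmentP; exists i.
Qed.

Lemma segment_sum f n : (forall i, (i < n)%N -> up_step (f i) (f i.+1)) ->
  forall i, (i <= n)%N -> (f i).1 + (f i).2 = (f 0%N).1 + (f 0%N).2 + i%:Z.
Proof.
move=> up; elim=> [|i IH] hi; first by rewrite addr0.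
by rewrite (up_step_sum (up i hi)) IH 1?ltnW //; lia.
Qed.

Lemma grow_segment l f n : wf l -> f 0%N \in verts l ->
  (forall i, (i < n)%N -> up_step (f i) (f i.+1)) ->
  (forall i, (i < n)%N -> f i.+1 \notin verts l) ->
  wf (grow l (segment f n)).
Proof.
move=> w f0 up fr.
have : (n <= n)%N by []; elim: {-2}n => [|m IH] mn //.
rewrite /segment -addn1 iotaD map_cat /= add0n -/(segment f m) grow_cat.
rewrite -[grow _ [:: _]]/((f m.+1, f m) :: grow l (segment f m)) wf_cons.
apply/and4P; split; [exact: IH (ltnW mn) | | | exact: up].
- rewrite verts_grow negb_or fr // andbT; apply/segment_childP => -[i im /= e].
  have := segment_sum up mn; have := @segment_sum f n up i.+1; rewrite e; lia.
- rewrite verts_grow; case: m {IH} mn => [|m] mn; first by rewrite f0 orbT.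
  by apply/orP; left; apply/segment_childP; exists m.
Qed.

Lemma segment_tpath l f n i : wf l -> {subset segment f n <= l} ->
  (i <= n)%N -> f 0%N \in verts l -> f 0%N \in tpath l (f i).
Proof.
move=> w sub; elim: i => [|i IH] hi f0; first exact: mem_tpath.
rewrite (@tpath_child _ _ (f i) w) ?inE ?IH ?orbT 1?ltnW //.
by apply: sub; apply/segmentP; exists i.
Qed.


(** * Scales and lanes *)
Section Params.
Variable K : nat.

(** The large exponents make room for the following separation of scales:
    [teeth s] is negligible before [column s], which is negligible before
    [anchor s.+1], which is a fixed fraction of
    [column s.+1 = teeth s * teeth s]. *)
Definition scale (s : nat) : nat := (s + K + 7)%N.
Definition column (s : nat) : nat := (2 ^ (2 * scale s ^ 2))%N.
Definition teeth (s : nat) : nat := (2 ^ ((scale s).+1 ^ 2))%N.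
Definition anchor (s : nat) : nat := (2 ^ (2 * scale s ^ 2 - 2))%N.

Lemma scaleS s : scale s.+1 = (scale s).+1.
Proof. by []. Qed.

Lemma scale_gt s : (s + 6 < scale s)%N.
Proof. rewrite /scale; lia. Qed.

Lemma teeth_gt0 s : (0 < teeth s)%N.
Proof. by rewrite expn_gt0. Qed.

Lemma anchor_gt0 s : (0 < anchor s)%N.
Proof. by rewrite expn_gt0. Qed.

Lemma column_anchor s : column s = (4 * anchor s)%N.
Proof.
rewrite /column /anchor -[4%N]/(2 ^ 2)%N -expnD; congr (2 ^ _)%N.
have := scale_gt s; nia.
Qed.

Lemma colS s : column s.+1 = (teeth s * teeth s)%N.
Proof. by rewrite /column scaleS mul2n -addnn expnD. Qed.

Lemma double_teeth s : (2 * teeth s <= teeth s.+1)%N.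
Proof. by rewrite -expnS leq_pexp2l // scaleS; nia. Qed.

(** The inequality behind the bound on the risk of a stage that starts at the
    walker's own tip ([risk_entry]). *)
Lemma stage_cost s :
  (4 ^ (scale s).+1 * (s.+2 + s.+2 * teeth s) <= column s)%N.
Proof.
have h2 : (s.+2 <= 2 ^ scale s)%N.
  by apply: (leq_trans _ (ltnW (ltn_expl _ _))) => //; have := scale_gt s; lia.
apply: (@leq_trans (4 ^ (scale s).+1 * (2 ^ scale s * (2 * teeth s)))%N).
  rewrite leq_mul2l; apply/orP; right.
  apply: (@leq_trans (s.+2 * (2 * teeth s))%N); last by rewrite leq_mul2r h2 orbT.
  by have := teeth_gt0 s; nia.
rewrite /teeth /column -[4%N]/(2 ^ 2)%N -expnM -expnS -!expnD leq_pexp2l //.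
have := scale_gt s; nia.
Qed.

(** The inequality behind the bound on the risk of the first stage of a walker
    ([risk_launch]), which starts at the origin. *)
Lemma launch_cost s :
  (2 * 4 ^ scale s * s.+1 * (column s + anchor s + 3 + (s + 3) * teeth s)
     <= anchor s.+1)%N.
Proof.
have h1 : (s.+1 <= 2 ^ scale s)%N.
  by apply: (leq_trans _ (ltnW (ltn_expl _ _))) => //; have := scale_gt s; lia.
have h2 : ((s + 3) * teeth s + 3 <= 2 * column s)%N.
  have h := stage_cost s; have h4 : (1 < 4 ^ (scale s).+1)%N.
    by rewrite -{1}(expn0 4) ltn_exp2l.
  have := teeth_gt0 s; nia.
apply: (@leq_trans (2 * 4 ^ scale s * 2 ^ scale s * (4 * column s))%N).
  apply: leq_mul; first by rewrite leq_mul2l h1 orbT.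
  have := column_anchor s; lia.
rewrite /anchor /column scaleS -[4%N]/(2 ^ 2)%N -expnM -expnS -!expnD leq_pexp2l //.
have := scale_gt s; nia.
Qed.

Lemma anchor_step s :
  (column s + anchor s + 3 + (s + 3) * teeth s <= anchor s.+1)%N.
Proof.
apply: leq_trans (launch_cost s); apply: leq_pmull.
by rewrite !muln_gt0 expn_gt0.
Qed.

Lemma column_step s : (column s + s + 2 <= column s.+1)%N.
Proof.
have := anchor_step s; rewrite (column_anchor s.+1); have := teeth_gt0 s; nia.
Qed.

Lemma leq_column s s' : (s <= s')%N -> (column s <= column s')%N.
Proof.
elim: s' => [|n IH]; first by rewrite leqn0 => /eqP ->.
by rewrite leq_eqVlt ltnS => /orP[/eqP ->//|/IH]; have := column_step n; lia.
Qed.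

(** The lanes of the walkers [w <= s] occupy at level [s] slots of [teeth s]
    rows each; the next lane must leave the trunk above all of them. *)
Lemma anchor_lt s s' : (s < s')%N ->
  (anchor s + (s + 2) * teeth s'.-1 < anchor s')%N.
Proof.
case: s' => // n; rewrite ltnS [n.+1.-1]/=; elim: n => [|n IH].
  by rewrite leqn0 => /eqP -> /=; have := anchor_step 0; lia.
rewrite leq_eqVlt ltnS => /orP[/eqP ->|sn].
  have := anchor_step n.+1; rewrite /=; nia.
have h : (s + 2 <= n.+1 + 3)%N by lia.
have := leq_mul h (leqnn (teeth n.+1)).
rewrite /=; have := anchor_step n.+1; have := IH sn; lia.
Qed.

(* Only the inequalities above are used from here on. *)
Opaque column teeth anchor.

(** At level [s], walker [w] enters the column [column s] at a row [y] such
    that [lo s w <= y < hi s w], and leaves it through a tooth in a row between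
    [lo s.+1 w] and [hi s.+1 w].  At its first level [s = w] it enters at the
    row [anchor w] of its corridor. *)
Definition lo (s w : nat) : nat :=
  (anchor w + w.+1 * (if w < s then teeth s.-1 else 0))%N.
Definition hi (s w : nat) : nat :=
  (lo s w + (if w < s then teeth s.-1 else 1))%N.
(** The spines of the higher lanes stand further to the left, so that a spine
    climbing to its slot does not cross the lanes above it. *)
Definition spine (s w : nat) : nat := (column s + 1 + (s - w))%N.

(** The corridor from the trunk to [column w]; then, at each level [s >= w],
    the entrance to the left of the spine, the column of the spine and the
    teeth to its right. *)
Definition lane (w x y : nat) : Prop :=
  [/\ 0 < x, x <= column w & y = anchor w]%N \/
  exists2 s : nat, (w <= s)%N & (column s < x <= column s.+1)%N /\
    [\/ (x <= spine s w)%N /\ (lo s w <= y < hi s w)%N,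
        x = spine s w /\ (lo s w <= y < hi s.+1 w)%N |
        (spine s w < x)%N /\ (lo s.+1 w <= y < hi s.+1 w)%N].

Lemma loE s w : (w <= s)%N -> lo s.+1 w = (anchor w + w.+1 * teeth s)%N.
Proof. by rewrite /lo ltnS => ->. Qed.

Lemma hiE s w : (w <= s)%N -> hi s.+1 w = (anchor w + w.+2 * teeth s)%N.
Proof. by move=> ws; rewrite /hi loE // ltnS ws /= -addnA -mulSnr. Qed.

Lemma entry_below s w : (w <= s)%N -> (hi s w <= lo s.+1 w)%N.
Proof.
move=> ws; rewrite loE // /hi /lo; case: ltnP => h; last first.
  have := leq_mul (leqnn w.+1) (teeth_gt0 s); lia.
case: s {ws} h => // s h /=.
have := leq_mul (leqnn w.+1) (double_teeth s); nia.
Qed.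

Lemma hi_lo s w w' : (w < w')%N -> (w' <= s)%N -> (hi s w <= lo s w')%N.
Proof.
move=> ww; rewrite leq_eqVlt => /orP[/eqP e|w's].
  have := anchor_lt ww; rewrite -e /hi /lo ltnn ww; lia.
by have := anchor_lt ww; rewrite /hi /lo w's (ltn_trans ww w's); nia.
Qed.

Lemma hi_anchor s w w' : (w <= s)%N -> (s < w')%N -> (hi s.+1 w <= anchor w')%N.
Proof.
move=> ws sw; rewrite hiE //.
have := anchor_lt (leq_ltn_trans ws sw).
have : (teeth s <= teeth w'.-1)%N.
  case: w' sw => // w'; rewrite ltnS /=; elim: w' => [|n IH].
    by rewrite leqn0 => /eqP ->.
  rewrite leq_eqVlt ltnS => /orP[/eqP ->//|/IH]; have := double_teeth n; lia.
nia.
Qed.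

Lemma lane_pos w x y : lane w x y -> (0 < x)%N.
Proof. by case=> [[]//|[s _ [/andP[h _] _]]]; apply: leq_trans h. Qed.

Lemma level_uniq s s' x : (column s < x <= column s.+1)%N ->
  (column s' < x <= column s'.+1)%N -> s = s'.
Proof.
move=> h h'; case: (ltngtP s s') => // l; have := leq_column l; lia.
Qed.

(** In every column the lanes occur in the order of the walkers; in particular
    they are disjoint. *)
Lemma lane_order w w' x y y' : lane w x y -> lane w' x y' -> (w < w')%N ->
  (y < y')%N.
Proof.
have rl : (w < w' -> anchor w < anchor w')%N by move=> /anchor_lt; lia.
case=> [[x0 xw ->]|[s ws [hx hy]]] [[x0' xw' ->]|[s' ws' [hx' hy']]] ww.
- exact: rl.
- have := leq_column (leq_trans (ltnW ww) ws'); lia.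
- have sw' : (s < w')%N.
    by rewrite ltnNge; apply/negP => /leq_column; lia.
  have h1 := hi_anchor ws sw'; have h2 := entry_below ws.
  have h3 : (lo s.+1 w <= hi s.+1 w)%N by rewrite leq_addr.
  by case: hy => -[]; lia.
- have es := level_uniq hx hx'; subst s'.
  have cc : (spine s w' < spine s w)%N by rewrite /spine; lia.
  have h1 := hi_lo ww ws'; have h2 : (hi s.+1 w <= lo s.+1 w')%N.
    by apply: hi_lo => //; lia.
  have h3 := entry_below ws; have h4 := entry_below ws'.
  have h5 : (lo s w' <= hi s w')%N by rewrite leq_addr.
  by case: hy => -[]; case: hy' => -[]; lia.
Qed.
End Params.

(** * Combs *)
Definition pt (x y : nat) : site := (x%:Z, y%:Z).

Lemma pt_inj x y x' y' : pt x y = pt x' y' -> x = x' /\ y = y'.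
Proof. by case=> -> ->. Qed.

Lemma up_right x y : up_step (pt x y) (pt x.+1 y).
Proof.
apply/orP; left; apply/eqP; rewrite /pt -addn1 PoszD.
by rewrite -[RHS]/(_, _) /= addr0.
Qed.

Lemma up_above x y : up_step (pt x y) (pt x y.+1).
Proof.
apply/orP; right; apply/eqP; rewrite /pt -addn1 PoszD.
by rewrite -[RHS]/(_, _) /= addr0.
Qed.

Section Blocks.
Variable K : nat.
Local Notation column := (column K).
Local Notation teeth := (teeth K).
Local Notation anchor := (anchor K).
Local Notation lo := (lo K).
Local Notation hi := (hi K).
Local Notation spine := (spine K).
Local Notation lane := (lane K).

Definition tooth (s w j : nat) : seq (site * site) :=
  segment (fun i => pt (spine s w + i) (lo s.+1 w + j)) (column s.+1 - spine s w).

(** The comb of walker [w] at level [s], when its tip is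
    [pt (column s) y]. *)
Definition block (s w y : nat) : seq (site * site) :=
  segment (fun i => pt (column s + i) y) (spine s w - column s)
  ++ segment (fun i => pt (spine s w) (y + i)) (hi s.+1 w - y.+1)
  ++ flatten [seq tooth s w j | j <- iota 0 (teeth s)].

(** What is added to the trunk for the first stage of walker [s]: the trunk up
    to the root of the next lane, and the corridor of walker [s]. *)
Definition launch (s : nat) : seq (site * site) :=
  segment (fun i => pt 0 (anchor s + i)) (anchor s.+1 - anchor s)
  ++ segment (fun i => pt i (anchor s)) (column s).

Definition extension (s w y : nat) : seq (site * site) :=
  (if w == s then launch s else [::]) ++ block s w y.

Lemma column_gt0 s : (0 < column s)%N.
Proof. by rewrite column_anchor muln_gt0 anchor_gt0. Qed.

Lemma spine_bounds s w : (w <= s)%N ->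
  (column s < spine s w)%N /\ (spine s w < column s.+1)%N.
Proof. by move=> ws; have := column_step K s; rewrite /spine; lia. Qed.

Lemma lane_uniq w w' x y : lane w x y -> lane w' x y -> w = w'.
Proof.
case: (ltngtP w w') => // h l l'.
  by have := lane_order l l' h; rewrite ltnn.
by have := lane_order l' l h; rewrite ltnn.
Qed.

Lemma entry_lane s w y : (w <= s)%N -> (lo s w <= y < hi s w)%N ->
  lane w (column s) y.
Proof.
rewrite leq_eqVlt => /orP[/eqP ->|ws] hy.
  left; split; rewrite ?column_gt0 //; move: hy; rewrite /hi /lo ltnn; lia.
case: s ws hy => // s; rewrite ltnS => ws hy.
right; exists s => //; split; first by have := column_step K s; lia.
have [h1 h2] := spine_bounds ws.
have := column_step K s; rewrite /spine.
by move=> h; apply: Or33; split=> //; lia.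
Qed.


Lemma hi_loD s w : (w <= s)%N -> hi s.+1 w = (lo s.+1 w + teeth s)%N.
Proof. by move=> ws; rewrite /hi ltnS ws. Qed.

Lemma blockP s w y e : reflect
  [\/ exists2 i, (i < spine s w - column s)%N &
        e = (pt (column s + i.+1) y, pt (column s + i) y),
      exists2 i, (i < hi s.+1 w - y.+1)%N &
        e = (pt (spine s w) (y + i.+1), pt (spine s w) (y + i)) |
      exists2 j, (j < teeth s)%N & exists2 i, (i < column s.+1 - spine s w)%N &
        e = (pt (spine s w + i.+1) (lo s.+1 w + j),
             pt (spine s w + i) (lo s.+1 w + j))]
  (e \in block s w y).
Proof.
rewrite !mem_cat; apply: (iffP or3P) => -[].
- by move=> /segmentP; constructor.
- by move=> /segmentP; constructor.
- move=> /flattenP[es /mapP[j]]; rewrite mem_iota => jt -> /segmentP h.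
  by apply: Or33; exists j.
- by move=> h; apply: Or31; apply/segmentP.
- by move=> h; apply: Or32; apply/segmentP.
- move=> [j jt h]; apply: Or33; apply/flattenP; exists (tooth s w j).
    by apply/mapP; exists j => //; rewrite mem_iota.
  exact/segmentP.
Qed.

Lemma lane_entry_row s w x y : (w <= s)%N -> (lo s w <= y < hi s w)%N ->
  (column s < x <= spine s w)%N -> lane w x y.
Proof.
move=> ws hy hx; right; exists s => //; split.
  by have [] := spine_bounds ws; lia.
by apply: Or31; split; [lia|].
Qed.

Lemma lane_spine s w y : (w <= s)%N -> (lo s w <= y < hi s.+1 w)%N ->
  lane w (spine s w) y.
Proof.
move=> ws hy; right; exists s => //; have [h1 h2] := spine_bounds ws.
by split; [lia|apply: Or32].
Qed.

Lemma lane_tooth s w x y : (w <= s)%N -> (spine s w < x <= column s.+1)%N ->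
  (lo s.+1 w <= y < hi s.+1 w)%N -> lane w x y.
Proof.
move=> ws hx hy; right; exists s => //; have [h1 h2] := spine_bounds ws.
by split; [lia|apply: Or33; split; [lia|]].
Qed.

(** Every edge of a comb lies in the lane of its walker, and the comb hangs on
    [pt (column s) y] only. *)
Lemma block_edge s w y c p : (w <= s)%N -> (lo s w <= y < hi s w)%N ->
  (c, p) \in block s w y ->
  exists x z, [/\ c = pt x z, lane w x z, (column s < x <= column s.+1)%N &
    (exists x' z', p = pt x' z' /\ lane w x' z') /\
    (p = pt (column s) y \/ p \in unzip1 (block s w y))].
Proof.
move=> ws hy; have [b1 b2] := spine_bounds ws; have b3 := entry_below K ws.
have b4 := hi_loD ws; have b5 : (lo s w <= lo s.+1 w)%N by lia.
have b6 := teeth_gt0 K s.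
case/blockP => [[i hi' [-> ->]]|[i hi' [-> ->]]|[j hj [i hi' [-> ->]]]].
- exists (column s + i.+1)%N, y; split=> //; first 1 last.
  + lia.
  + case: i hi' => [|i] hi'.
      rewrite addn0; split; last by left.
      by exists (column s), y; split=> //; apply: entry_lane.
    split.
      exists (column s + i.+1)%N, y; split=> //.
      by apply: (@lane_entry_row s) => //; lia.
    right; apply/mapP; exists (pt (column s + i.+1) y, pt (column s + i) y) => //.
    by apply/blockP; apply: Or31; exists i => //; lia.
  + by apply: (@lane_entry_row s) => //; lia.
- exists (spine s w), (y + i.+1)%N; split=> //; first 1 last.
  + lia.
  + split.
      by exists (spine s w), (y + i)%N; split=> //; apply: lane_spine => //; lia.
    right; apply/mapP; case: i hi' => [|i] hi'.
      exists (pt (spine s w) y, pt (column s + (spine s w - column s).-1) y).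
        apply/blockP; apply: Or31; exists (spine s w - column s).-1; first lia.
        by congr (pt _ _, _); lia.
      by rewrite addn0.
    exists (pt (spine s w) (y + i.+1), pt (spine s w) (y + i)) => //.
    by apply/blockP; apply: Or32; exists i => //; lia.
  + by apply: lane_spine => //; lia.
- exists (spine s w + i.+1)%N, (lo s.+1 w + j)%N; split=> //; first 1 last.
  + lia.
  + case: i hi' => [|i] hi'.
      rewrite addn0; split.
        exists (spine s w), (lo s.+1 w + j)%N; split=> //.
        by apply: lane_spine => //; lia.
      right; apply/mapP; pose i := (lo s.+1 w + j - y.+1)%N.
      exists (pt (spine s w) (y + i.+1), pt (spine s w) (y + i)).
        by apply/blockP; apply: Or32; exists i => //; rewrite /i; lia.
      by congr pt; rewrite /i; lia.
    split.
      exists (spine s w + i.+1)%N, (lo s.+1 w + j)%N; split=> //.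
      by apply: (@lane_tooth s) => //; lia.
    right; apply/mapP; exists (pt (spine s w + i.+1) (lo s.+1 w + j),
      pt (spine s w + i) (lo s.+1 w + j)) => //.
    by apply/blockP; apply: Or33; exists j => //; exists i => //; lia.
  + by apply: (@lane_tooth s) => //; lia.
Qed.

Lemma wf_grow_teeth l s w n : wf l -> (n <= teeth s)%N ->
  (forall j, (j < n)%N -> pt (spine s w) (lo s.+1 w + j) \in verts l) ->
  (forall x j, (spine s w < x <= column s.+1)%N -> (j < n)%N ->
     pt x (lo s.+1 w + j) \notin verts l) ->
  wf (grow l (flatten [seq tooth s w j | j <- iota 0 n])).
Proof.
move=> wl; elim: n => [|n IH] // hn hs hf.
rewrite -addn1 iotaD map_cat flatten_cat /= cats0 add0n grow_cat.
apply: grow_segment.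
- by apply: IH => [|j jn|x j hx jn]; [lia|apply: hs; lia|apply: hf; lia].
- by rewrite addn0 verts_grow hs ?orbT.
- by move=> i _; rewrite addnS; apply: up_right.
- move=> i hi'; rewrite verts_grow negb_or hf ?andbT //; last by lia.
  apply/mapP => -[e /flattenP[es /mapP[j]]]; rewrite mem_iota => hj ->.
  by move=> /segmentP[i' _ ->] /= /pt_inj[]; lia.
Qed.

Lemma wf_grow_block l s w y : (w <= s)%N -> (lo s w <= y < hi s w)%N ->
  wf l -> pt (column s) y \in verts l ->
  (forall x z, lane w x z -> (column s < x)%N -> pt x z \notin verts l) ->
  wf (grow l (block s w y)).
Proof.
move=> ws hy wl el fr; rewrite /block !grow_cat.
have [b1 b2] := spine_bounds ws; have b3 := entry_below K ws.
have b4 := hi_loD ws; have b5 : (lo s w <= lo s.+1 w)%N by lia.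
have w1 : wf (grow l (segment (fun i => pt (column s + i) y)
                              (spine s w - column s))).
  apply: grow_segment; rewrite ?addn0 // => i hi'.
  - by rewrite addnS; apply: up_right.
  - by apply: fr; [apply: (@lane_entry_row s) => //|]; lia.
have w2 : wf (grow (grow l (segment (fun i => pt (column s + i) y)
                                    (spine s w - column s)))
            (segment (fun i => pt (spine s w) (y + i)) (hi s.+1 w - y.+1))).
  apply: grow_segment => // [|i hi'|i hi'].
  - rewrite verts_grow; apply/orP; left; apply/segment_childP.
    by exists (spine s w - column s).-1; [|congr pt]; lia.
  - by rewrite addnS; apply: up_above.
  - rewrite verts_grow negb_or fr ?andbT //; last by apply: lane_spine => //; lia.
    by apply/segment_childP => -[i' _ /pt_inj[]]; lia.
apply: wf_grow_teeth => // [j hj|x j hx hj].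
- rewrite verts_grow; apply/orP; left; apply/segment_childP.
  by exists (lo s.+1 w + j - y.+1)%N; [|congr pt]; lia.
- rewrite 2!verts_grow 2!negb_or fr ?andbT; first 1 last.
  + by apply: (@lane_tooth s) => //; lia.
  + lia.
  by apply/andP; split; apply/segment_childP => -[i' hi' /pt_inj[]]; lia.
Qed.

End Blocks.

(** * Stages of the exploration *)
Section Stages.
Variable K : nat.
Local Notation column := (column K).
Local Notation teeth := (teeth K).
Local Notation anchor := (anchor K).
Local Notation lo := (lo K).
Local Notation hi := (hi K).
Local Notation spine := (spine K).
Local Notation lane := (lane K).
Local Notation block := (block K).
Local Notation launch := (launch K).
Local Notation extension := (extension K).

(** The sites through which a path from the root to lane [w] may go: the trunk
    below the root of the lane, and the lane. *)
Definition arm (w : nat) (v : site) : Prop :=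
  (exists2 y, (y <= anchor w)%N & v = pt 0 y) \/
  exists x y, v = pt x y /\ lane w x y.

(** The vertex on which the stage [(s, w)] hangs its extension. *)
Definition base (s w y : nat) : site :=
  if w == s then pt 0 (anchor s) else pt (column s) y.

Lemma anchor_incr s s' : (s < s')%N -> (anchor s < anchor s')%N.
Proof. by move=> /(anchor_lt K); lia. Qed.

Lemma arm_lane w w' x y : arm w' (pt x y) -> lane w x y -> w' = w.
Proof.
move=> [[z _ /pt_inj[-> _] /lane_pos //]|[x' [y' [/pt_inj[-> ->] l']]] l].
exact: lane_uniq l' l.
Qed.

Lemma launchP s e : reflect
  ((exists2 i, (i < anchor s.+1 - anchor s)%N &
      e = (pt 0 (anchor s + i.+1), pt 0 (anchor s + i))) \/
   (exists2 i, (i < column s)%N & e = (pt i.+1 (anchor s), pt i (anchor s))))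
  (e \in launch s).
Proof.
by rewrite mem_cat; apply: (iffP orP) => -[/segmentP|/segmentP]; by [left|right].
Qed.

Lemma extension_edge s w y c p : (w <= s)%N -> (lo s w <= y < hi s w)%N ->
  (c, p) \in extension s w y ->
  [/\ forall w', arm w' c -> arm w' p,
      p = base s w y \/ p \in unzip1 (extension s w y) &
      (exists z, [/\ c = pt 0 z, (anchor s < z <= anchor s.+1)%N & w = s]) \/
      (exists x z, [/\ c = pt x z, lane w x z, (x <= column s.+1)%N &
         (column s < x)%N \/ w = s])].
Proof.
move=> ws hy; rewrite mem_cat => /orP[|h]; last first.
  have [x [z [ec lc hx [[x' [z' [ep lp]] hp]]]]] := block_edge ws hy h.
  split.
  - move=> w'; rewrite ec => /arm_lane/(_ lc) ->.
    by right; exists x', z'.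
  - case: hp => hp; last by right; rewrite /unzip1 map_cat mem_cat hp orbT.
    rewrite /base hp; case: eqP => [e|_]; last by left.
    right; rewrite /unzip1 map_cat mem_cat -e eqxx; apply/orP; left.
    have c0 := column_gt0 K w.
    apply/mapP.
    exists (pt (column w).-1.+1 (anchor w), pt (column w).-1 (anchor w)).
      by apply/launchP; right; exists (column w).-1 => //; lia.
    congr pt; first lia.
    by move: hy; rewrite -e /hi /lo ltnn; lia.
  - by right; exists x, z; split=> //; [|left]; lia.
case: eqP => // e; subst w => /launchP[[i hi' [-> ->]]|[i hi' [-> ->]]].
- split.
  + move=> w' [[z hz /pt_inj[_ ez]]|[x [z [/pt_inj[<- _] /lane_pos //]]]].
    by left; exists (anchor s + i)%N => //; lia.
  + case: i hi' => [|i] hi'; first by left; rewrite /base eqxx addn0.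
    right; apply/mapP; exists (pt 0 (anchor s + i.+1), pt 0 (anchor s + i)) => //.
    rewrite /extension eqxx mem_cat; apply/orP; left.
    by apply/launchP; left; exists i => //; lia.
  + by left; exists (anchor s + i.+1)%N; split=> //; lia.
- have ls x : (0 < x <= column s)%N -> lane s x (anchor s).
    by move=> h; left; split; lia.
  split.
  + move=> w' /arm_lane/(_ (ls _ _)) -> //.
    case: i hi' => [|i] hi'; first by left; exists (anchor s).
    by right; exists i.+1, (anchor s); split=> //; apply: ls; lia.
  + case: i hi' => [|i] hi'; first by left; rewrite /base eqxx.
    right; apply/mapP; exists (pt i.+1 (anchor s), pt i (anchor s)) => //.
    rewrite /extension eqxx mem_cat; apply/orP; left.
    by apply/launchP; right; exists i => //; lia.
  + right; exists i.+1, (anchor s); split=> //; last by right.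
      by apply: ls; lia.
    by have := column_step K s; lia.
Qed.

(** The level already reached by walker [w'] when the stage [(s, w)]
    begins. *)
Definition level (s w w' : nat) : nat := if (w' < w)%N then s.+1 else s.

(** [row w'] is the row in which walker [w'] arrived at its current tip; for a
    walker that has not been launched it is the row of its corridor. *)
Definition tip (s w : nat) (row : nat -> nat) (w' : nat) : site :=
  pt (column (level s w w')) (row w').

(** The part of the plane that the earlier stages may have used; [ready_in]
    makes the sites needed by the stage [(s, w)] fresh. *)
Definition territory (s w : nat) (v : site) : Prop :=
  (exists2 y, (y <= anchor s)%N & v = pt 0 y) \/
  exists w' x y, [/\ v = pt x y, lane w' x y, (w' < s)%N \/ (w' < w)%N &
    (x <= column (level s w w'))%N].

(** The invariant at the beginning of the stage [(s, w)].  By [ready_arm] two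
    vertices in different lanes have only vertices of the trunk as common
    ancestors. *)
Record ready (s w : nat) (l : tree) (row : nat -> nat) (pos : nat -> site) : Prop :=
  Ready {
    ready_le : (w <= s)%N;
    ready_wf : wf l;
    ready_in : forall v, v \in verts l -> territory s w v;
    ready_arm : forall c p, (c, p) \in l -> forall w', arm w' c -> arm w' p;
    ready_row : forall w',
      (lo (level s w w') w' <= row w' < hi (level s w w') w')%N;
    ready_trunk : pt 0 (anchor s) \in verts l;
    ready_tip : forall w', (w' < s)%N -> tip s w row w' \in verts l;
    ready_pos : forall w',
      pos w' = if (w' < s)%N then tip s w row w' else origin }.

Definition next_stage (s w : nat) : nat * nat :=
  if (w < s)%N then (s, w.+1) else (s.+1, 0%N).

Definition ends (s w : nat) : seq site :=
  [seq pt (column s.+1) (lo s.+1 w + j) | j <- iota 0 (teeth s)].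

Definition trunk_top (s w : nat) : site :=
  pt 0 (if w == s then anchor s.+1 else anchor s).

(** The sites where a later stage of another walker, or the launch of the next
    one, will attach edges. *)
Definition foreign (s w : nat) (row : nat -> nat) : seq site :=
  trunk_top s w :: [seq tip s w row w' | w' <- iota 0 s & w' != w].

Section Extend.
Variables (s w : nat) (l : tree) (row : nat -> nat) (pos : nat -> site).
Hypothesis rdy : ready s w l row pos.

Let ws : (w <= s)%N := ready_le rdy.
Let wl : wf l := ready_wf rdy.

Lemma own_row : (lo s w <= row w < hi s w)%N.
Proof. by have := ready_row rdy w; rewrite /level ltnn. Qed.

Local Notation ext := (extension s w (row w)).

Lemma fresh_child c : c \in unzip1 ext -> c \notin verts l.
Proof.
case/mapP=> -[c' p] h /= ->; apply/negP => /(ready_in rdy).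
have [_ _] := extension_edge ws own_row h.
case=> [[z [-> hz e]]|[x [z [-> lx hx hs]]]].
- case=> [[y hy /pt_inj[_ ?]]|[w' [x [y [/pt_inj[<- _] /lane_pos //]]]]]; lia.
- case=> [[y hy /pt_inj[e _]]|[w' [x' [y [/pt_inj[<- <-] l' hw hx']]]]].
    by move: (lane_pos lx); rewrite e.
  move: hw hx'; rewrite (lane_uniq l' lx) /level ltnn; case: hs; lia.
Qed.

(** So a stage changes the neighbourhood of only one of the old vertices. *)
Lemma parent_base c p : (c, p) \in ext -> p \in verts l -> p = base s w (row w).
Proof.
move=> h pv; have [_ [//|/fresh_child]] := extension_edge ws own_row h.
by rewrite pv.
Qed.

Lemma wf_extend : wf (grow l ext).
Proof.
have hy := own_row; have fr := fresh_child.
have c0 := column_gt0 K s.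
rewrite /extension grow_cat; case: eqP fr => [e|ne] fr; last first.
  apply: wf_grow_block => //=; first by have := ready_tip rdy (_ : w < s)%N;
    rewrite /tip /level ltnn; apply; lia.
  move=> x z lx hx; apply/negP => /(ready_in rdy).
  case=> [[y _ /pt_inj[e _]]|[w' [x' [y [/pt_inj[<- <-] l' _]]]]].
    by move: (lane_pos lx); rewrite e.
  by rewrite (lane_uniq l' lx) /level ltnn; lia.
have ls x : (0 < x <= column s)%N -> lane s x (anchor s).
  by move=> h; left; split; lia.
have out w' x z : lane w' x z -> w' = s -> pt x z \notin verts l.
  move=> lx ew'; apply/negP => /(ready_in rdy).
  case=> [[y _ /pt_inj[ex _]]|[w'' [x' [y [/pt_inj[<- <-] l' hw _]]]]].
    by move: (lane_pos lx); rewrite ex.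
  by move: hw; rewrite (lane_uniq l' lx); lia.
have w1 : wf (grow l (segment (fun i => pt 0 (anchor s + i))
                              (anchor s.+1 - anchor s))).
  apply: grow_segment => // [|i _|i hi'].
  - by rewrite addn0 (ready_trunk rdy).
  - by rewrite addnS; apply: up_above.
  - apply/negP => /(ready_in rdy).
    case=> [[y ? /pt_inj[]]|[w' [x [y [/pt_inj[<- _] /lane_pos //]]]]]; lia.
rewrite /launch grow_cat; apply: wf_grow_block => //.
- apply: grow_segment => // [|i _|i hi'].
  + by rewrite verts_grow (ready_trunk rdy) orbT.
  + exact: up_right.
  + rewrite verts_grow negb_or (out s) ?andbT //; last by apply: ls; lia.
    by apply/segment_childP => -[i' _ /pt_inj[]].
- rewrite verts_grow; apply/orP; left; apply/segment_childP.
  exists (column s).-1; [|congr pt]; try lia.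
  by move: hy; rewrite e /hi /lo ltnn; lia.
- move=> x z lx hx; rewrite 2!verts_grow 2!negb_or (out w) ?andbT //.
  apply/andP; split; apply/segment_childP => -[i hi' /pt_inj[]].
    by lia.
  by lia.
Qed.

Lemma verts_extend v : (v \in verts (grow l ext)) =
  (v \in unzip1 ext) || (v \in verts l).
Proof. exact: verts_grow. Qed.

Lemma territory_extend v : v \in verts (grow l ext) ->
  territory (next_stage s w).1 (next_stage s w).2 v.
Proof.
rewrite verts_extend => /orP[/mapP[[c p] h /= ->]|/(ready_in rdy)].
  have [_ _] := extension_edge ws own_row h.
  have lv : column s.+1 = column (level (next_stage s w).1 (next_stage s w).2 w).
    by rewrite /next_stage /level; case: (ltnP w s) => /= _; rewrite ?ltnSn.
  case=> [[z [-> hz e]]|[x [z [-> lx hx hs]]]].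
    by left; exists z => //; rewrite /next_stage e ltnn /=; lia.
  right; exists w, x, z; split=> //; last by rewrite -lv.
  by rewrite /next_stage; case: (ltnP w s) => /=; lia.
case=> [[y hy ->]|[w' [x [y [-> lx hw hx]]]]].
  left; exists y => //; rewrite /next_stage; case: (ltnP w s) => //= _.
  by have := anchor_incr (ltnSn s); lia.
right; exists w', x, y; split=> //.
  by rewrite /next_stage; case: (ltnP w s) => /=; lia.
apply: leq_trans hx _; apply: leq_column.
rewrite /next_stage /level; case: (ltnP w s) => /= ?; do ?case: ifP => ?; lia.
Qed.

Lemma arm_extend c p : (c, p) \in grow l ext ->
  forall w', arm w' c -> arm w' p.
Proof.
rewrite mem_grow => /orP[h|]; last exact: (ready_arm rdy).
by have [] := extension_edge ws own_row h.
Qed.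

Lemma trunk_extend : trunk_top s w \in verts (grow l ext).
Proof.
rewrite verts_extend /trunk_top; case: eqP => [e|_]; last first.
  by rewrite (ready_trunk rdy) orbT.
apply/orP; left; have := anchor_incr (ltnSn s) => h.
apply/mapP; exists (pt 0 (anchor s + (anchor s.+1 - anchor s).-1.+1),
                    pt 0 (anchor s + (anchor s.+1 - anchor s).-1)).
  rewrite /extension e eqxx mem_cat; apply/orP; left.
  by apply/launchP; left; exists (anchor s.+1 - anchor s).-1 => //; lia.
by congr pt; lia.
Qed.

Lemma ends_child v : v \in ends s w -> v \in unzip1 ext.
Proof.
case/mapP=> j; rewrite mem_iota => hj ->; have [b1 b2] := spine_bounds K ws.
rewrite /unzip1 map_cat mem_cat; apply/orP; right.
pose i := (column s.+1 - spine s w).-1.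
apply/mapP; exists (pt (spine s w + i.+1) (lo s.+1 w + j),
                    pt (spine s w + i) (lo s.+1 w + j)).
  by apply/blockP; apply: Or33; exists j => //; exists i => //; rewrite /i; lia.
by congr pt; rewrite /i; lia.
Qed.

Lemma ends_extend v : v \in ends s w -> v \in verts (grow l ext).
Proof. by rewrite verts_extend => /ends_child ->. Qed.

Lemma foreign_extend v : v \in foreign s w row -> v \in verts (grow l ext).
Proof.
rewrite inE => /orP[/eqP ->|/mapP[w']]; first exact: trunk_extend.
rewrite mem_filter mem_iota => /andP[_ hw] ->.
by rewrite verts_extend (ready_tip rdy) ?orbT.
Qed.

Section Arrive.
Variable (j : nat).
Hypothesis hj : (j < teeth s)%N.

Let row' w' := if w' == w then (lo s.+1 w + j)%N else row w'.
Let pos' w' := if w' == w then pt (column s.+1) (lo s.+1 w + j) else pos w'.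

Lemma tip_next w' : (w' < (next_stage s w).1)%N ->
  tip (next_stage s w).1 (next_stage s w).2 row' w'
    = if w' == w then pt (column s.+1) (lo s.+1 w + j) else tip s w row w'.
Proof.
rewrite /tip /row' /level /next_stage; case: eqP => [->|ne].
  by case: (ltnP w s) => //=; rewrite ltnSn.
by case: (ltnP w s) => /= ? ?; congr (pt (column _) _); do ?case: ifP => ?; lia.
Qed.

(** The stage [(s, w)] ends when walker [w] is at the far end of the tooth
    number [j]. *)
Lemma ready_next :
  ready (next_stage s w).1 (next_stage s w).2 (grow l ext) row' pos'.
Proof.
split.
- by rewrite /next_stage; case: ltnP.
- exact: wf_extend.
- exact: territory_extend.
- exact: arm_extend.
- move=> w'; rewrite /row'; case: eqP => [->|ne].
    have -> : level (next_stage s w).1 (next_stage s w).2 w = s.+1.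
      by rewrite /level /next_stage; case: (ltnP w s) => //=; rewrite ltnSn.
    by rewrite hi_loD //; lia.
  have h := ready_row rdy w'.
  suff -> : level (next_stage s w).1 (next_stage s w).2 w' =
    if (w' < w)%N then s.+1 else if (s <= w)%N then s.+1 else s.
    move: h; rewrite /level; case: (ltnP w' w) => // ww; case: (leqP s w) => // sw.
    have e : w = s by lia.
    rewrite /lo /hi /lo !ifF //; lia.
  by rewrite /level /next_stage; case: (ltnP w s) => /= ?; do ?case: ifP => ?; lia.
- have := trunk_extend; rewrite /trunk_top /next_stage; case: (ltnP w s) => h.
    by have -> : (w == s) = false by lia.
  by have -> : w == s by lia.
- move=> w' hw; rewrite tip_next //; case: eqP => [_|ne].
    apply: ends_extend; apply/mapP; exists j => //.
    by rewrite mem_iota.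
  rewrite verts_extend (ready_tip rdy) ?orbT //.
  by move: hw; rewrite /next_stage; case: (ltnP w s) => /=; lia.
- move=> w'; rewrite /pos' (ready_pos rdy).
  case: (ltnP w' (next_stage s w).1) => hw.
    rewrite tip_next //; case: eqP => // ne; rewrite ifT //.
    by move: hw; rewrite /next_stage; case: (ltnP w s) => /=; lia.
  have -> : (w' < s)%N = false.
    by move: hw; rewrite /next_stage; case: ltnP => /=; lia.
  by have -> : (w' == w) = false
    by move: hw; rewrite /next_stage; case: (ltnP w s) => /=; lia.
Qed.

End Arrive.

End Extend.
End Stages.

(** * Common ancestors in a tree with a comb *)
Definition height (u : site) : int := u.1 + u.2.

Lemma height_child (c p : site) : up_step p c -> height c = height p + 1.
Proof. exact: up_step_sum. Qed.

Lemma tpath_suffix_le l (u v : site) : wf l -> v \in verts l ->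
  u \in tpath l v -> u.1 <= v.1 /\ height u <= height v.
Proof.
move=> w; move: v; apply: tpath_ind => //.
  by rewrite tpath_origin // inE => /eqP ->.
move=> c p h IH; rewrite (tpath_child w h) inE => /orP[/eqP ->//|/IH[h1 h2]].
rewrite (height_child (wf_up w h)); split; last by lia.
by case/orP: (wf_up w h) => /eqP ->; case: p {IH h} h1 h2 => x y /=; lia.
Qed.

Lemma tpath_uniq l v : wf l -> v \in verts l ->
  uniq (map height (tpath l v)).
Proof.
move=> w; move: v; apply: tpath_ind => //; first by rewrite tpath_origin.
move=> c p h IH; rewrite (tpath_child w h) /= IH andbT.
apply/negP => /mapP[u up e].
have [_] := tpath_suffix_le w (wf_parent_mem w h) up.
by rewrite -e (height_child (wf_up w h)); lia.
Qed.

Lemma count_mem_le (T : eqType) (a s : seq T) : uniq s ->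
  (count (mem a) s <= size a)%N.
Proof.
move=> us; rewrite -size_filter; apply: uniq_leq_size; first exact: filter_uniq.
by move=> x; rewrite mem_filter => /andP[].
Qed.

Lemma common_size l t v : wf l -> v \in verts l ->
  (common l t v <= size (tpath l t))%N.
Proof. by move=> w vV; apply: count_mem_le; apply: map_uniq (tpath_uniq w vV). Qed.

(** [u] is the last common ancestor. *)
Lemma common_deepest l t v : wf l -> t \in verts l -> v \in verts l ->
  exists u, [/\ u \in tpath l t, u \in tpath l v &
                (common l t v <= size (tpath l u))%N].
Proof.
move=> w tV; move: v; apply: tpath_ind => //.
  exists origin; split; first exact: tpath_on_origin.
    by rewrite tpath_origin // inE.
  by rewrite common_origin // tpath_origin.
move=> c p h [u [u1 u2 u3]]; have [ct|ct] := boolP (c \in tpath l t).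
  exists c; split=> //; last exact: common_le.
  by apply: mem_tpath => //; apply: mem_verts_child h.
exists u; split; rewrite ?(tpath_child w h) ?inE ?u2 ?orbT //.
by rewrite (common_child t w h) (negbTE ct).
Qed.

Section Gauge.
Variable K : nat.
Local Notation column := (column K).
Local Notation teeth := (teeth K).
Local Notation anchor := (anchor K).
Local Notation lo := (lo K).
Local Notation hi := (hi K).
Local Notation spine := (spine K).
Local Notation lane := (lane K).
Local Notation extension := (extension K).
Local Notation ends := (ends K).
Local Notation foreign := (foreign K).
Local Notation arm := (arm K).

Lemma size_tpath_pt l x y : wf l -> pt x y \in verts l ->
  size (tpath l (pt x y)) = (x + y + 1)%N.
Proof. by move=> w h; have := size_tpath w h; rewrite /=; lia. Qed.

(** An upper bound for the sum of [common l t v] over the far ends [t] of the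
    teeth: the path to an end has at most [spine s w + hi s.+1 w] vertices
    outside its tooth, and the vertices inside the teeth are accounted for by
    [sum_in_tooth]. *)
Definition cap (s w : nat) : nat :=
  (teeth s * (spine s w + hi s.+1 w) + column s.+1 + teeth s)%N.

Section Stage.
Variables (s w : nat) (l0 : tree) (row : nat -> nat) (pos : nat -> site).
Hypothesis rdy : ready K s w l0 row pos.
Let ws : (w <= s)%N := ready_le rdy.
Local Notation l := (grow l0 (extension s w (row w))).
Let wl : wf l := wf_extend rdy.

Lemma ext_sub : {subset extension s w (row w) <= l}.
Proof. by move=> e he; rewrite mem_grow he. Qed.

Lemma block_sub : {subset block K s w (row w) <= l}.
Proof. by move=> e he; apply: ext_sub; rewrite mem_cat he orbT. Qed.

Lemma spine_verts j : (j < teeth s)%N -> pt (spine s w) (lo s.+1 w + j) \in verts l.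
Proof.
move=> hj; have [b1 b2] := spine_bounds K ws.
have h : (pt (spine s w + 1) (lo s.+1 w + j), pt (spine s w) (lo s.+1 w + j))
   \in l.
  apply: block_sub; apply/blockP; apply: Or33.
  exists j => //; exists 0%N; first lia.
  by rewrite addn0.
exact: (wf_parent_mem wl h).
Qed.

Lemma entry_verts : pt (column s) (row w) \in verts l.
Proof.
have [b1 b2] := spine_bounds K ws.
have h : (pt (column s + 1) (row w), pt (column s) (row w)) \in l.
  apply: block_sub; apply/blockP; apply: Or31; exists 0%N; first lia.
  by rewrite addn0.
exact: (wf_parent_mem wl h).
Qed.

Lemma tooth_tpath j i u : (j < teeth s)%N -> (i <= column s.+1 - spine s w)%N ->
  u \in tpath l (pt (spine s w + i) (lo s.+1 w + j)) ->
  u \in tpath l (pt (spine s w) (lo s.+1 w + j)) \/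
  (u.2 == (lo s.+1 w + j)%:Z) &&
    ((spine s w)%:Z < u.1 <= (column s.+1)%:Z).
Proof.
move=> hj; elim: i => [|i IH] hi'; first by rewrite addn0; left.
rewrite (@tpath_child _ _ (pt (spine s w + i) (lo s.+1 w + j)) wl); last first.
  apply: block_sub; apply/blockP; apply: Or33.
  by exists j => //; exists i.
rewrite inE => /orP[/eqP ->|]; last by apply: IH; lia.
by right; rewrite /= eqxx /=; lia.
Qed.

Definition in_tooth j (u : site) : bool :=
  (u.2 == (lo s.+1 w + j)%:Z) && ((spine s w)%:Z < u.1 <= (column s.+1)%:Z).

Lemma common_end j v : (j < teeth s)%N -> v \in verts l ->
  (common l (pt (column s.+1) (lo s.+1 w + j)) v
     <= spine s w + hi s.+1 w + count (in_tooth j) (tpath l v))%N.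
Proof.
move=> hj vV; have [b1 b2] := spine_bounds K ws.
have -> : pt (column s.+1) (lo s.+1 w + j) =
   pt (spine s w + (column s.+1 - spine s w)) (lo s.+1 w + j).
  by congr pt; lia.
rewrite /common; set t := pt (spine s w + _) _.
set sg := pt (spine s w) (lo s.+1 w + j).
apply: (@leq_trans (count (mem (tpath l sg)) (tpath l v) +
                    count (in_tooth j) (tpath l v))%N).
  rewrite -[leqRHS]count_predUI; apply: leq_trans (leq_addr _ _).
  apply: sub_count => u /= /(tooth_tpath hj (leqnn _))[h|h].
    by apply/orP; left.
  by apply/orP; right.
rewrite leq_add2r; apply: (leq_trans (common_size sg wl vV)).
rewrite size_tpath_pt ?spine_verts // hi_loD //; lia.
Qed.

(** The vertices counted on the left have different heights, which lie in an
    interval of [column s.+1 + teeth s] integers. *)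
Lemma sum_in_tooth v : v \in verts l ->
  (\sum_(j <- iota 0 (teeth s)) count (in_tooth j) (tpath l v)
     <= column s.+1 + teeth s)%N.
Proof.
move=> vV; pose Q (u : site) := ((spine s w)%:Z < u.1 <= (column s.+1)%:Z) &&
   ((lo s.+1 w)%:Z <= u.2 < (lo s.+1 w + teeth s)%:Z).
apply: (@leq_trans (count Q (tpath l v))).
  elim: (tpath l v) => [|u p IH] /=; first by rewrite big1.
  rewrite big_split /=; apply: leq_add => //.
  have [->|nQ] : (\sum_(j <- iota 0 (teeth s)) in_tooth j u = 0)%N \/
      exists2 j0, (j0 < teeth s)%N & in_tooth j0 u.
  - have [/hasP[j]|/hasPn h] := boolP (has (in_tooth^~ u) (iota 0 (teeth s))).
      by rewrite mem_iota => hj h; right; exists j.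
    by left; rewrite big_seq big1 // => j /h /negbTE ->.
  - by [].
  - case: nQ => j0 hj0 hu; have -> : Q u.
      by move: hu; rewrite /in_tooth /Q => /andP[/eqP -> ->] /=; lia.
    rewrite (bigD1_seq j0) ?iota_uniq ?mem_iota //= hu big1_seq // => j.
    case/andP=> nj _; apply/eqP; rewrite eqb0; apply: contra nj.
    by move: hu; rewrite /in_tooth => /andP[/eqP -> _] /andP[/eqP]; lia.
rewrite -size_filter -(size_map (fun u => absz (height u - (lo s.+1 w)%:Z))).
rewrite -[leqRHS](size_iota 0); apply: uniq_leq_size.
  rewrite map_inj_in_uniq ?filter_uniq ?(map_uniq (tpath_uniq wl vV)) //.
  move=> u u'; rewrite !mem_filter => /andP[q up] /andP[q' up'] e.
  have eh : height u = height u' by move: q q' e; rewrite /Q /height; lia.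
  have := tpath_uniq wl vV.
  move: (tpath l v) up up' eh => p; elim: p => //= x p IH.
  rewrite !inE => /orP[/eqP ->|up] /orP[/eqP ->|up'] eh // /andP[n un].
  - by case/negP: n; apply/mapP; exists u'.
  - by case/negP: n; apply/mapP; exists u.
  - exact: IH.
move=> n /mapP[u]; rewrite mem_filter => /andP[q _] ->.
by rewrite mem_iota; move: q; rewrite /Q /height; lia.
Qed.

Lemma sum_common_le v : v \in verts l ->
  (\sum_(t <- ends s w) common l t v <= cap s w)%N.
Proof.
move=> vV; rewrite big_map.
apply: (@leq_trans (\sum_(j <- iota 0 (teeth s))
   (spine s w + hi s.+1 w + count (in_tooth j) (tpath l v)))%N).
  rewrite big_seq [leqRHS]big_seq; apply: leq_sum => j; rewrite mem_iota => hj.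
  exact: common_end.
rewrite big_split /= /cap -addnA leq_add ?sum_in_tooth //.
by rewrite big_const_seq count_predT size_iota iter_addn_0 mulnC.
Qed.

End Stage.
End Gauge.

(** * The risk of a stage *)
Section Potential.
Variable K : nat.
Local Notation column := (column K).
Local Notation teeth := (teeth K).
Local Notation anchor := (anchor K).
Local Notation lo := (lo K).
Local Notation hi := (hi K).
Local Notation spine := (spine K).
Local Notation lane := (lane K).
Local Notation extension := (extension K).
Local Notation ends := (ends K).
Local Notation foreign := (foreign K).
Local Notation arm := (arm K).
Local Notation tip := (tip K).
Local Notation cap := (cap K).
Local Notation scale := (scale K).

Variable R : realType.

(** A stage that starts at the walker's own tip ([w < s]) has to avoid the part
    of the tree behind the tip, which contains the tips of the others.  The
    first stage of a walker ([w = s]) starts at the origin and has to avoid the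
    tips of the others, which have depth at least [anchor s.+1]. *)
Definition weight_away (s w : nat) : R :=
  if (w < s)%N then 0 else ((anchor s.+1)%:R)^-1.

(** For [w < s] this makes [risk] at least 1 once the walker has retreated to
    half of [column s] ([risk_near]).  For [w = s] it is the value for which
    the drifts at the root of the two sums in [risk] cancel; there are [s.+1]
    foreign tips. *)
Definition weight_back (s w : nat) : R :=
  if (w < s)%N then 2 / ((teeth s)%:R * (column s)%:R)
  else s.+1%:R / ((anchor s.+1)%:R * (teeth s)%:R).

(** A superharmonic function which is nonnegative, and at least 1 where the
    walker should not go; so its value bounds the probability to get there
    before the far end of a tooth. *)
Definition risk (s w : nat) (l : tree) (row : nat -> nat) (v : site) : R :=
  weight_away s w * \sum_(f <- foreign s w row) (common l f v)%:R +
  weight_back s w * ((cap s w)%:R - \sum_(t <- ends s w) (common l t v)%:R).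

Section Stage.
Variables (s w : nat) (l0 : tree) (row : nat -> nat) (pos : nat -> site).
Hypothesis rdy : ready K s w l0 row pos.
Let ws : (w <= s)%N := ready_le rdy.
Local Notation l := (grow l0 (extension s w (row w))).
Let wl : wf l := wf_extend rdy.

Lemma arm_tpath w' u v : v \in verts l -> arm w' v -> u \in tpath l v -> arm w' u.
Proof.
move: v; apply: (tpath_ind wl).
  by move=> h; rewrite tpath_origin // inE => /eqP ->.
move=> c p h IH ac; rewrite (tpath_child wl h) inE => /orP[/eqP ->//|].
by apply: IH; apply: (arm_extend rdy h).
Qed.

Lemma ends_lane t : t \in ends s w -> exists x y, t = pt x y /\ lane w x y.
Proof.
case/mapP=> j; rewrite mem_iota => hj ->; have [b1 b2] := spine_bounds K ws.
exists (column s.+1), (lo s.+1 w + j)%N; split=> //.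
by apply: (@lane_tooth _ s) => //; rewrite ?hi_loD //; lia.
Qed.

(** If no ancestor of [v] is in lane [w], then the last common ancestor of [v]
    and of [t] is a vertex of the trunk below the root of the lane. *)
Lemma common_off_lane t v : t \in ends s w -> v \in verts l ->
  (forall x y, lane w x y -> pt x y \notin tpath l v) ->
  (common l t v <= (anchor w).+1)%N.
Proof.
move=> te vV out; have tV := ends_extend rdy te.
have [u [ut uv h]] := common_deepest wl tV vV.
have : arm w u by apply: (arm_tpath tV _ ut); right; apply: ends_lane.
case=> [[y hy eu]|[x [y [eu lu]]]]; last first.
  by move: uv; rewrite eu (negbTE (out _ _ lu)).
apply: (leq_trans h); have uV := tpath_sub wl vV uv.
by rewrite eu size_tpath_pt -?eu //; lia.
Qed.

Lemma common_trunk t z : t \in ends s w -> pt 0 z \in verts l ->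
  (common l t (pt 0 z) <= (anchor w).+1)%N.
Proof.
move=> te zV; apply: common_off_lane => // x y lx; apply/negP => h.
have [h1 _] := tpath_suffix_le wl zV h.
by have := lane_pos lx; move: h1 => /=; lia.
Qed.

Lemma tip_lane w' : (w' < s)%N ->
  exists x y, tip s w row w' = pt x y /\ lane w' x y.
Proof.
move=> hw; exists (column (level s w w')), (row w'); split=> //.
apply: entry_lane; last exact: (ready_row rdy).
by rewrite /level; case: ifP; lia.
Qed.

Lemma common_foreign t v : t \in ends s w -> v \in foreign s w row ->
  (common l t v <= (anchor w).+1)%N.
Proof.
move=> te vf; have := foreign_extend rdy vf; move: vf.
rewrite inE => /orP[/eqP -> h|/mapP[w']]; first exact: common_trunk.
rewrite mem_filter mem_iota => /andP[ne hw] -> h.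
have [x [y [e lx]]] := tip_lane hw.
apply: common_off_lane => // x' y' lx'; apply/negP => hu.
have : arm w' (pt x' y') by apply: (arm_tpath h _ hu); right; exists x, y.
by move=> /arm_lane/(_ lx') e'; rewrite e' eqxx in ne.
Qed.

Lemma size_foreign : w = s -> size (foreign s w row) = s.+1.
Proof.
move=> e; rewrite /= size_map size_filter; congr _.+1.
rewrite -[RHS](size_iota 0); apply/eqP; rewrite -all_count; apply/allP => x.
by rewrite mem_iota /=; lia.
Qed.

Lemma foreign_far v : w = s -> v \in foreign s w row ->
  (anchor s.+1 <= size (tpath l v))%N.
Proof.
move=> e vf; have := foreign_extend rdy vf; move: vf.
rewrite inE => /orP[/eqP -> h|/mapP[w']].
  move: h; rewrite /trunk_top; case: eqP => // _ h.
  by rewrite (size_tpath_pt wl h); lia.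
rewrite mem_filter mem_iota => /andP[ne hw] -> h.
rewrite size_tpath_pt // /level e ifT; last by lia.
by have := column_anchor K s.+1; lia.
Qed.

Lemma weight_away_ge0 : 0 <= weight_away s w.
Proof. by rewrite /weight_away; case: ifP. Qed.

Lemma weight_back_ge0 : 0 <= weight_back s w.
Proof. by rewrite /weight_back; case: ifP => _; rewrite divr_ge0 // mulr_ge0. Qed.

Lemma cap_sum_ge0 v : v \in verts l ->
  0 <= (cap s w)%:R - \sum_(t <- ends s w) (common l t v)%:R :> R.
Proof.
move=> vV; rewrite subr_ge0 -natr_sum ler_nat.
exact: (sum_common_le rdy).
Qed.

Lemma risk_ge0 v : v \in verts l -> 0 <= risk s w l row v.
Proof.
move=> vV; rewrite addr_ge0 // mulr_ge0 ?weight_away_ge0 ?weight_back_ge0 //.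
  by rewrite sumr_ge0.
exact: cap_sum_ge0.
Qed.

Lemma sum_common_drift (ts : seq site) v : v \in verts l -> v \notin ts ->
  {subset ts <= verts l} ->
  \sum_a \sum_(t <- ts) (common l t (step l v a))%:R
   = (\sum_(t <- ts) (common l t v)%:R) *+ 4 + (size ts)%:R * (v == origin)%:R :> R.
Proof.
move=> vV; elim: ts => [|t ts IH].
  under eq_bigr do rewrite big_nil.
  by rewrite big_nil big1 // mul0rn mul0r addr0.
rewrite inE negb_or => /andP[nt nts] sub.
under eq_bigr do rewrite big_cons.
rewrite big_split /= IH // => [|x hx]; last by apply: sub; rewrite inE hx orbT.
have tV : t \in verts l by apply: sub; rewrite inE eqxx.
rewrite (common_drift _ wl tV vV nt) big_cons [size _]/= -natr1; ring.
Qed.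

(** By [sum_common_drift] the only drift is at the root, and there the part
    coming from the ends of the teeth has the good sign. *)
Lemma risk_drift v : v \in verts l -> v \notin ends s w ->
  ((w < s)%N \/ v \notin foreign s w row) ->
  \sum_a risk s w l row (step l v a) <= risk s w l row v *+ 4.
Proof.
move=> vV ve vf.
rewrite /risk big_split /= -!mulr_sumr sumrB sumr_const card_letter.
rewrite (sum_common_drift vV ve); last by move=> t; apply: (ends_extend rdy).
have R0 : 0 < (teeth s)%:R :> R by rewrite ltr0n teeth_gt0.
have sz : size (ends s w) = teeth s by rewrite size_map size_iota.
rewrite sz; set S := \sum_(t <- ends s w) _; set C := (cap s w)%:R.
set o := (v == origin)%:R.
have o0 : 0 <= o by rewrite /o.
have [sw|sw] := ltnP w s.
  have -> : weight_away s w = 0 by rewrite /weight_away sw.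
  rewrite !mul0r !add0r -mulrnAr mulrnBl ler_wpM2l ?weight_back_ge0 //.
  by rewrite lerD2l lerN2 lerDl mulr_ge0 // ltW.
have e : w = s by apply/eqP; rewrite eqn_leq ws sw.
case: vf => [|vf]; first by rewrite ltnNge sw.
rewrite (sum_common_drift vV vf); last by move=> t; apply: (foreign_extend rdy).
rewrite (size_foreign e) /weight_away /weight_back ltnNge sw /=.
set F := \sum_(f <- foreign s w row) _.
have A0 : 0 < (anchor s.+1)%:R :> R by rewrite ltr0n anchor_gt0.
rewrite le_eqVlt; apply/orP; left; apply/eqP; field.
by rewrite !gt_eqF.
Qed.

(** Here [2 * anchor s] is one half of [column s], and the depth of the tip of
    the walker exceeds [column s]. *)
Lemma risk_near v : v \in verts l -> (w < s)%N ->
  (forall t, t \in ends s w -> (common l t v <= 2 * anchor s)%N) ->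
  1 <= risk s w l row v.
Proof.
move=> vV sw h; rewrite /risk /weight_away /weight_back sw mul0r add0r.
have R0 : 0 < (teeth s)%:R :> R by rewrite ltr0n teeth_gt0.
have C0 : 0 < (column s)%:R :> R by rewrite ltr0n column_gt0.
have hS : (\sum_(t <- ends s w) common l t v <= teeth s * (2 * anchor s))%N.
  apply: (@leq_trans (\sum_(t <- ends s w) 2 * anchor s)%N).
    by rewrite big_seq [leqRHS]big_seq; apply: leq_sum => t /h.
  by rewrite big_const_seq count_predT size_map size_iota iter_addn_0 mulnC.
have hC : (teeth s * column s <= cap s w)%N.
  rewrite /cap -addnA; apply: leq_trans (leq_addr _ _).
  by rewrite leq_mul2l; have [b1 _] := spine_bounds K ws; apply/orP; right; lia.
rewrite mulrAC ler_pdivlMr ?mulr_gt0 // mul1r -natr_sum -natrB; last first.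
  exact: (sum_common_le rdy vV).
rewrite -!natrM ler_nat; have := column_anchor K s.
move: (\sum_(t <- _) _)%N hS => S; nia.
Qed.

Lemma anchor_le_half : (w < s)%N -> ((anchor w).+1 <= 2 * anchor s)%N.
Proof. by move=> /(@anchor_incr K); lia. Qed.

Lemma risk_foreign v : v \in foreign s w row -> 1 <= risk s w l row v.
Proof.
move=> vf; have vV := foreign_extend rdy vf.
have [sw|sw] := ltnP w s.
  apply: risk_near => // t te; apply: (leq_trans (common_foreign te vf)).
  exact: anchor_le_half.
have e : w = s by apply/eqP; rewrite eqn_leq ws sw.
rewrite /risk ler_wpDr ?mulr_ge0 ?weight_back_ge0 ?cap_sum_ge0 //.
rewrite /weight_away ltnNge sw /= mulrC ler_pdivlMr ?ltr0n ?anchor_gt0 // mul1r.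
apply: (@le_trans _ _ (common l v v)%:R).
  by rewrite ler_nat common_anc ?mem_tpath // foreign_far.
by rewrite (big_rem v) //= lerDl sumr_ge0.
Qed.

Lemma risk_trunk z : (w < s)%N -> pt 0 z \in verts l ->
  1 <= risk s w l row (pt 0 z).
Proof.
move=> sw zV; apply: risk_near => // t te.
apply: (leq_trans (common_trunk te zV)); exact: anchor_le_half.
Qed.

Lemma risk_low v : (w < s)%N -> v \in verts l ->
  (size (tpath l v) <= 2 * anchor s)%N -> 1 <= risk s w l row v.
Proof.
by move=> sw vV h; apply: risk_near => // t _; apply: leq_trans (common_le l t v) h.
Qed.

(** All paths to the ends of the comb pass through the tip that carries it. *)
Lemma entry_tpath t : t \in ends s w -> pt (column s) (row w) \in tpath l t.
Proof.
case/mapP=> j; rewrite mem_iota => hj ->; have [b1 b2] := spine_bounds K ws.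
have hb : {subset block K s w (row w) <= l} := @block_sub K s w l0 row.
have hr := own_row rdy.
have b3 := entry_below K ws; have b4 := hi_loD K ws.
have eV := entry_verts rdy.
have s1 : pt (column s) (row w) \in tpath l (pt (spine s w) (row w)).
  have := @segment_tpath l (fun i => pt (column s + i) (row w))
    (spine s w - column s) (spine s w - column s) wl.
  rewrite addn0 (_ : column s + (spine s w - column s) = spine s w)%N; last lia.
  by apply=> // x hx; apply: hb; rewrite mem_cat hx.
have s1V : pt (spine s w) (row w) \in verts l.
  apply: (wf_parent_mem wl (c := pt (spine s w) (row w + 1))); apply: hb.
  by apply/blockP; apply: Or32; exists 0%N; rewrite ?addn0 //; lia.
have s2 : pt (spine s w) (row w) \in
    tpath l (pt (spine s w) (lo s.+1 w + j)).
  have := @segment_tpath l (fun i => pt (spine s w) (row w + i))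
    (hi s.+1 w - (row w).+1) (lo s.+1 w + j - row w) wl.
  rewrite addn0 (_ : row w + (lo s.+1 w + j - row w) = lo s.+1 w + j)%N; last lia.
  by apply=> //; [move=> x hx; apply: hb; rewrite !mem_cat hx orbT | lia].
have s2V := spine_verts rdy hj.
have s3 : pt (spine s w) (lo s.+1 w + j) \in
    tpath l (pt (column s.+1) (lo s.+1 w + j)).
  have := @segment_tpath l (fun i => pt (spine s w + i) (lo s.+1 w + j))
    (column s.+1 - spine s w) (column s.+1 - spine s w) wl.
  have -> : (spine s w + (column s.+1 - spine s w) = column s.+1)%N by lia.
  rewrite addn0; apply=> //; move=> x hx; apply: hb; rewrite !mem_cat; apply/orP; right.
  apply/orP; right; apply/flattenP; exists (tooth K s w j) => //.
  by apply/mapP; exists j => //; rewrite mem_iota.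
have tV : pt (column s.+1) (lo s.+1 w + j) \in verts l.
  by apply: (ends_extend rdy); apply/mapP; exists j => //; rewrite mem_iota.
exact: (tpath_trans wl tV (tpath_trans wl s2V s1 s2) s3).
Qed.

Lemma risk_entry : (w < s)%N ->
  risk s w l row (pt (column s) (row w)) <= (2 * 4 ^ scale s)%:R^-1.
Proof.
move=> sw; rewrite /risk /weight_away /weight_back sw mul0r add0r.
have R0 : 0 < (teeth s)%:R :> R by rewrite ltr0n teeth_gt0.
have C0 : 0 < (column s)%:R :> R by rewrite ltr0n column_gt0.
have -> : \sum_(t <- ends s w) (common l t (pt (column s) (row w)))%:R
   = (teeth s * (column s + row w + 1))%:R :> R.
  rewrite big_seq (eq_bigr (fun=> (column s + row w + 1)%:R)); last first.
    move=> t te; rewrite common_anc ?entry_tpath ?(ends_extend rdy) //.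
    by rewrite size_tpath_pt // (entry_verts rdy).
  rewrite -big_seq big_const_seq count_predT size_map size_iota iter_addr_0.
  by rewrite natrM mulr_natl.
have hr := own_row rdy; have hE := hiE K ws; have hl : (anchor w <= lo s w)%N.
  by rewrite /lo leq_addr.
have hcap : (cap s w <= teeth s * (column s + row w + 1) +
                        teeth s * (s.+2 + s.+2 * teeth s))%N.
  rewrite /cap colS hE /spine.
  have h1 : (column s + 1 + (s - w) + (anchor w + w.+2 * teeth s)
      <= (column s + row w + 1) + (s + s.+1 * teeth s))%N.
    have h0 : (w.+2 <= s.+1)%N by [].
    by have := leq_mul h0 (leqnn (teeth s)); lia.
  have := leq_mul (leqnn (teeth s)) h1; lia.
have hc := stage_cost K s.
rewrite mulrAC ler_pdivrMr ?mulr_gt0 //.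
apply: (@le_trans _ _ (2 * ((teeth s) * (s.+2 + s.+2 * teeth s))%:R)).
  by rewrite ler_wpM2l // lerBlDl -natrD ler_nat.
rewrite [leRHS]mulrC ler_pdivlMr ?ltr0n ?muln_gt0 ?expn_gt0 //.
rewrite -!natrM ler_nat; have := leq_mul (leqnn (teeth s)) hc.
rewrite expnS; lia.
Qed.

Lemma risk_launch : w = s -> risk s w l row origin <= (2 * 4 ^ scale s)%:R^-1.
Proof.
move=> e; rewrite /risk /weight_away /weight_back e ltnn.
have R0 : 0 < (teeth s)%:R :> R by rewrite ltr0n teeth_gt0.
have A0 : 0 < (anchor s.+1)%:R :> R by rewrite ltr0n anchor_gt0.
have sum1 (ts : seq site) : {subset ts <= verts l} ->
    \sum_(t <- ts) (common l t origin)%:R = (size ts)%:R :> R.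
  move=> sub; rewrite big_seq (eq_bigr (fun=> 1)) => [|t /sub tV]; last first.
    by rewrite common_origin.
  by rewrite -big_seq big_const_seq count_predT iter_addr_0.
have := sum1 _ (foreign_extend rdy); rewrite (size_foreign e) e => ->.
have := sum1 _ (ends_extend rdy); rewrite e => ->.
rewrite size_map size_iota.
have hcap : (cap s s = teeth s +
    teeth s * (column s + anchor s + 1 + (s + 3) * teeth s))%N.
  by rewrite /cap colS hiE // /spine subnn; lia.
rewrite hcap natrD [_ + _ - _]addrAC subrr add0r natrM addrC.
set Z := (_ + _ + _ + _)%N.
have -> : s.+1%:R / ((anchor s.+1)%:R * (teeth s)%:R) * ((teeth s)%:R * Z%:R)
    + (anchor s.+1)%:R^-1 * s.+1%:R = (s.+1 * Z.+1)%:R / (anchor s.+1)%:R :> R.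
  by rewrite natrM -natr1; field; rewrite !gt_eqF.
rewrite ler_pdivrMr // [leRHS]mulrC ler_pdivlMr ?ltr0n ?muln_gt0 ?expn_gt0 //.
rewrite -!natrM ler_nat; apply: leq_trans (launch_cost K s).
rewrite mulnC mulnA leq_mul2l; apply/orP; right; rewrite /Z; lia.
Qed.

End Stage.
End Potential.

(** * The exploration and its supermartingale *)
Section Exploration.
Variables (K : nat) (R : realType).
Local Notation column := (column K).
Local Notation teeth := (teeth K).
Local Notation anchor := (anchor K).
Local Notation lo := (lo K).
Local Notation hi := (hi K).
Local Notation extension := (extension K).
Local Notation ends := (ends K).
Local Notation scale := (scale K).
Local Notation risk := (risk K R).

(** During the stage [(lvl, cur)], [clock] counts the letters read since its
    beginning. *)
Record state := State {
  lvl : nat; cur : nat; tr : tree; row : nat -> nat; pos : nat -> site;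
  clock : nat }.

Definition enter s w l row pos : state :=
  State s w (grow l (extension s w (row w))) row pos 0.

Definition depth (l : tree) : nat := \max_(v <- verts l) size (tpath l v).

Definition goal (s w : nat) : site := pt (column s.+1) (lo s.+1 w).

(** The time allotted to a stage, so large that half of the budget of the stage
    covers the probability of running out of time ([delay_start]). *)
Definition patience (s : nat) (l : tree) : nat :=
  (8 * 5 ^ (depth l).*2 * 4 ^ scale s)%N.

Definition delay (s w : nat) (l : tree) (v : site) (c : nat) : R :=
  (4 * lag l (goal s w) (depth l) v + c)%:R / (patience s l)%:R.

(** A bound for the budgets of all the stages after [(s, w)], each stage of
    level [s] being given [1 / 4 ^ scale s]. *)
Definition reserve (s w : nat) : R :=
  (s - w)%:R / (4 ^ scale s)%:R + 2 / (2 ^ scale s)%:R.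

Definition gauge (st : state) : R :=
  let v := pos st (cur st) in
  risk (lvl st) (cur st) (tr st) (row st) v
  + delay (lvl st) (cur st) (tr st) v (clock st) + reserve (lvl st) (cur st).

Definition lost (st : state) : bool := 1 <= gauge st.

Definition set_at (T : Type) (f : nat -> T) (w : nat) (x : T) : nat -> T :=
  fun w' => if w' == w then x else f w'.

Definition move (st : state) (a : letter) : state :=
  let s := lvl st in let w := cur st in
  let v := step (tr st) (pos st w) a in
  if v \in ends s w then
    enter (next_stage s w).1 (next_stage s w).2 (tr st)
      (set_at (row st) w (absz v.2)) (set_at (pos st) w v)
  else State s w (tr st) (row st) (set_at (pos st) w v) (clock st).+1.

(** The exploration freezes when it is lost, which makes the events of being
    lost after [n] letters increase with [n]. *)
Definition advance (st : state) (a : letter) : state :=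
  if lost st then st else move st a.

Definition valid (st : state) : Prop :=
  exists l0 pos0, [/\ ready K (lvl st) (cur st) l0 (row st) pos0,
    tr st = grow l0 (extension (lvl st) (cur st) (row st (cur st))),
    forall w', w' != cur st -> pos st w' = pos0 w',
    pos st (cur st) \in verts (tr st) &
    pos st (cur st) \notin ends (lvl st) (cur st)].

Lemma depth_max l v : v \in verts l -> (size (tpath l v) <= depth l)%N.
Proof. by move=> vV; rewrite /depth (big_rem v) //= leq_maxl. Qed.

Lemma patience_gt0 s l : (0 < patience s l)%N.
Proof. by rewrite !muln_gt0 !expn_gt0. Qed.

Lemma delay_ge0 s w l v c : 0 <= delay s w l v c.
Proof. by rewrite divr_ge0. Qed.

Lemma reserve_ge0 s w : 0 <= reserve s w.
Proof. by rewrite addr_ge0 ?divr_ge0. Qed.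

(** At the end of a stage the reserve pays for the budget of the next one. *)
Lemma reserve_next s w : (w <= s)%N ->
  ((4 ^ scale (next_stage s w).1)%:R)^-1 +
    reserve (next_stage s w).1 (next_stage s w).2 <= reserve s w.
Proof.
rewrite leq_eqVlt /next_stage => /orP[/eqP ->|sw].
  rewrite ltnn /reserve /= subn0 subnn mul0r add0r scaleS.
  have h : (s.+2 <= 4 * 2 ^ scale s)%N.
    by have := ltn_expl (scale s) (isT : 1 < 2)%N; have := scale_gt K s; lia.
  have x0 : 0 < (2 ^ scale s)%:R :> R by rewrite ltr0n expn_gt0.
  have e4 : (4 ^ scale s = 2 ^ scale s * 2 ^ scale s)%N by rewrite -expnMn.
  rewrite !expnS e4 !natrM.
  set x := (2 ^ scale s)%:R in x0 *.
  have {}h : s.+2%:R <= 4 * x by rewrite -natrM ler_nat.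
  rewrite -subr_ge0.
  have -> : 2 / x - ((4 * (x * x))^-1 + (s.+1%:R / (4 * (x * x)) + 2 / (2 * x)))
     = (4 * x - s.+2%:R) / (4 * (x * x)).
    by rewrite -(natr1 s.+1); field; rewrite gt_eqF.
  by rewrite divr_ge0 ?subr_ge0 // !mulr_ge0 // ltW.
rewrite sw /reserve /= addrA lerD2r.
by rewrite -[X in X + _]mul1r -mulrDl ler_wpM2r // nat1r ler_nat; lia.
Qed.

Lemma delay_start s w l v :
  delay s w l v 0 <= ((2 * 4 ^ scale s)%:R)^-1.
Proof.
rewrite /delay addn0 ler_pdivrMr ?ltr0n ?patience_gt0 // mulrC.
rewrite ler_pdivlMr ?ltr0n ?muln_gt0 ?expn_gt0 // -natrM ler_nat.
apply: (@leq_trans (4 * 5 ^ (depth l).*2 * (2 * 4 ^ scale s))%N).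
  by rewrite leq_mul2r leq_mul2l leq_subr !orbT.
by rewrite /patience; lia.
Qed.

Lemma start_pos s w l row pos : ready K s w l row pos ->
  pos w = if (w < s)%N then pt (column s) (row w) else origin.
Proof.
by move=> rdy; rewrite (ready_pos rdy) /tip /level ltnn.
Qed.

(** One half of the budget of a stage pays for its risk, the other half for its
    duration. *)
Lemma gauge_enter s w l row pos : ready K s w l row pos ->
  gauge (enter s w l row pos) <= ((4 ^ scale s)%:R)^-1 + reserve s w.
Proof.
move=> rdy; rewrite /gauge /= lerD2r.
have -> : (4 ^ scale s)%:R^-1 =
  (2 * 4 ^ scale s)%:R^-1 + (2 * 4 ^ scale s)%:R^-1 :> R.
  by rewrite natrM; field; rewrite pnatr_eq0 -lt0n expn_gt0.
apply: lerD; last exact: delay_start.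
rewrite (start_pos rdy); case: ltnP => h; first exact: (risk_entry R rdy).
by apply: (risk_launch R rdy); have := ready_le rdy; lia.
Qed.

Lemma valid_enter s w l row pos : ready K s w l row pos ->
  valid (enter s w l row pos).
Proof.
move=> rdy; exists l, pos; split=> //=.
  rewrite (start_pos rdy) verts_extend; case: ltnP => h; last first.
    by rewrite [_ \in verts l]inE eqxx orbT.
  by have := ready_tip rdy h; rewrite /tip /level ltnn => ->; rewrite orbT.
rewrite (start_pos rdy); apply/mapP => -[j _]; have h1 := column_step K s.
have h2 := column_gt0 K s.+1.
by case: ltnP => _ /pt_inj[]; lia.
Qed.

Lemma valid_arrive st v : valid st -> v \in ends (lvl st) (cur st) ->
  let n := next_stage (lvl st) (cur st) in
  ready K n.1 n.2 (tr st) (set_at (row st) (cur st) (absz v.2))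
    (set_at (pos st) (cur st) v).
Proof.
case=> l0 [pos0 [rdy e off inV out]] /mapP[j]; rewrite mem_iota => hj ->.
have := ready_next rdy (j := j) hj; rewrite -e /=.
set end_j := pt _ _ => h.
suff <- : (fun w' => if w' == cur st then end_j else pos0 w') =
          set_at (pos st) (cur st) end_j by [].
by apply: funext => w'; rewrite /set_at; case: eqP => // /eqP ne; rewrite off.
Qed.

Lemma valid_move st a : valid st -> valid (move st a).
Proof.
move=> vld; rewrite /move; case: ifP => [ve|/negbT ve].
  exact/valid_enter/valid_arrive.
case: vld => l0 [pos0 [rdy e off inV out]].
exists l0, pos0; split; rewrite /= /set_at ?eqxx //.
  by move=> w' ne; rewrite (negbTE ne) off.
by apply: step_verts => //; rewrite e; apply: wf_extend rdy.
Qed.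

Lemma valid_advance st a : valid st -> valid (advance st a).
Proof. by rewrite /advance; case: ifP => // _; apply: valid_move. Qed.

Lemma valid_risk_ge0 st : valid st ->
  forall v, v \in verts (tr st) -> 0 <= risk (lvl st) (cur st) (tr st) (row st) v.
Proof.
by case=> l0 [pos0 [rdy e _ _ _]] v; rewrite e; apply: (risk_ge0 R rdy).
Qed.

Lemma not_lost_risk st : valid st -> ~~ lost st ->
  risk (lvl st) (cur st) (tr st) (row st) (pos st (cur st)) < 1.
Proof.
move=> [l0 [pos0 [rdy e _ _ _]]]; rewrite /lost -ltNge => h.
apply: le_lt_trans h; rewrite /gauge -addrA lerDl.
by rewrite addr_ge0 ?delay_ge0 ?reserve_ge0.
Qed.

(** If the stage goes on, the three terms are dealt with by [risk_drift],
    [lag_drift] and equality.  If it ends, the new gauge is at most the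
    reserve, and the terms that are dropped are nonnegative. *)
Lemma gauge_drift st : valid st ->
  \sum_a gauge (advance st a) <= gauge st *+ 4.
Proof.
move=> vld; rewrite /advance; case: (boolP (lost st)) => [_|nl].
  by rewrite sumr_const card_letter.
have [l0 [pos0 [rdy e off inV out]]] := vld.
set s := lvl st in rdy e out *; set w := cur st in rdy e off inV out *.
set v := pos st w in inV out *.
have wl : wf (tr st) by rewrite e; apply: wf_extend rdy.
have gV : goal s w \in verts (tr st).
  rewrite e; apply: (ends_extend rdy); apply/mapP; exists 0%N.
    by rewrite mem_iota teeth_gt0.
  by rewrite /goal addn0.
have le_gauge a : gauge (move st a) <=
   risk s w (tr st) (row st) (step (tr st) v a) +
   delay s w (tr st) (step (tr st) v a) (clock st).+1 + reserve s w.
  have vV : step (tr st) v a \in verts (tr st) by apply: step_verts.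
  have := valid_move a vld; rewrite /move -/s -/w -/v.
  case: ifP => [ve|_] vld'; last by rewrite /gauge /= /set_at eqxx.
  apply: (@le_trans _ _ (reserve s w)).
    apply: le_trans (reserve_next (ready_le rdy)); apply: gauge_enter.
    exact: valid_arrive.
  rewrite lerDr addr_ge0 ?delay_ge0 //; exact: valid_risk_ge0.
apply: (le_trans (ler_sum _ (fun a _ => le_gauge a))).
rewrite 2!big_split /= sumr_const card_letter /gauge -/s -/w -/v.
have -> (x y z : R) : (x + y + z) *+ 4 = x *+ 4 + y *+ 4 + z *+ 4.
  by rewrite !mulrnDl.
apply: lerD => //; apply: lerD.
  rewrite e; apply: (risk_drift R rdy) => //; first by rewrite -e.
  case: (ltnP w s) => sw; [by left|right].
  apply/negP => /(risk_foreign R rdy).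
  by rewrite leNgt -e => /negP; apply; apply: not_lost_risk.
rewrite /delay -mulr_suml -mulrnAl ler_wpM2r // -mulr_natr -natr_sum -natrM ler_nat.
rewrite big_split /= -big_distrr /= sum_nat_const card_letter.
have ng : v != goal s w.
  apply: contraNneq out => ->; apply/mapP; exists 0%N.
    by rewrite mem_iota teeth_gt0.
  by rewrite /goal addn0.
have := lag_drift wl gV inV ng (@depth_max _).
move: (\sum_(i : letter) _)%N (lag _ _ _ v) (clock st) => L la c; lia.
Qed.

(** A stage that has used up its time has a delay of at least 1. *)
Lemma clock_bound st : valid st -> ~~ lost st ->
  (clock st < patience (lvl st) (tr st))%N.
Proof.
move=> vld; rewrite /lost -ltNge => h; rewrite ltnNge; apply/negP => hc.
have [l0 [pos0 [rdy e off inV out]]] := vld.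
move: h; apply/negP; rewrite -leNgt /gauge.
rewrite ler_wpDr ?reserve_ge0 // ler_wpDl ?valid_risk_ge0 //.
rewrite /delay ler_pdivlMr ?ltr0n ?patience_gt0 // mul1r ler_nat.
by apply: leq_trans hc _; rewrite leq_addl.
Qed.

Definition trunk0 : tree := grow [::] (segment (pt 0) (anchor 0)).

Lemma ready0 : ready K 0 0 trunk0 anchor (fun=> origin).
Proof.
have inT v : v \in verts trunk0 -> exists2 y, (y <= anchor 0)%N & v = pt 0 y.
  rewrite verts_grow => /orP[/segment_childP[i hi' ->]|].
    by exists i.+1.
  by rewrite inE => /eqP ->; exists 0%N.
split=> //.
- by apply: grow_segment => // i _; apply: up_above.
- by move=> v /inT[y h ->]; left; exists y.
- move=> c p; rewrite mem_grow orbF => /segmentP[i hi' [-> ->]] w'.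
  case=> [[y hy /pt_inj[_ ey]]|[x [y [/pt_inj[<- _] /lane_pos //]]]].
  by left; exists i => //; lia.
- by move=> w'; rewrite /level /lo /hi /lo /= muln0 addn0; lia.
- rewrite verts_grow; apply/orP; left; apply/segment_childP.
  have h := anchor_gt0 K 0; exists (anchor 0).-1; first lia.
  by congr pt; lia.
Qed.

Definition state0 : state := enter 0 0 trunk0 anchor (fun=> origin).

Lemma valid0 : valid state0.
Proof. exact: valid_enter ready0. Qed.

Lemma gauge0 : gauge state0 <= 3 / (2 ^ K)%:R.
Proof.
apply: (le_trans (gauge_enter ready0)); rewrite /reserve mul0r add0r.
have x0 : 0 < (2 ^ K)%:R :> R by rewrite ltr0n expn_gt0.
have -> : 3 / (2 ^ K)%:R = 1 / (2 ^ K)%:R + 2 / (2 ^ K)%:R :> R.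
  by field; rewrite gt_eqF.
have le k : (2 ^ K <= 2 ^ (K + k))%N by rewrite leq_pexp2l // leq_addr.
apply: lerD; last first.
  rewrite ler_wpM2l // lef_pV2 ?posrE ?ltr0n ?expn_gt0 // ler_nat.
  by rewrite /scale add0n le.
rewrite mul1r lef_pV2 ?posrE ?ltr0n ?expn_gt0 // ler_nat.
rewrite -[4%N]/(2 ^ 2)%N -expnM leq_pexp2l // /scale; lia.
Qed.

End Exploration.

(** * Reading independent words adaptively *)
Lemma independent_prefix d (T : measurableType d) (R : realType)
    (P : probability T R) (F : nat -> set (set T)) (A : nat -> set T) n :
  independent P F -> (forall i, (i < n)%N -> F i (A i)) ->
  P (\bigcap_(i in `I_n) A i) = (\prod_(i <- iota 0 n) P (A i))%E.
Proof.
move=> ind hA; pose J := [fset i | i in iota 0 n]%fset.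
have JE i : (i \in J) = (i < n)%N by rewrite in_fset /= mem_iota.
have := ind J A; rewrite (_ : [set` J] = `I_n); last first.
  by apply/seteqP; split=> i /=; rewrite JE.
move=> -> => [|j]; last by rewrite JE; apply: hA.
apply: perm_big; apply: uniq_perm; rewrite ?fset_uniq ?iota_uniq // => i.
by rewrite JE mem_iota.
Qed.

(** A process with states in [S] reads, in the state [s], the first unread
    letter of the word number [active s].  A pair of type [S * (nat -> nat)]
    holds the state and the number of letters already read from each word. *)
Section ReadOnce.
Variables (S : Type) (active : S -> nat) (upd : S -> letter -> S) (s0 : S).

Definition tick (sc : S * (nat -> nat)) (a : letter) : S * (nat -> nat) :=
  (upd sc.1 a, fun j => if j == active sc.1 then (sc.2 j).+1 else sc.2 j).

Definition after (u : seq letter) : S * (nat -> nat) :=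
  foldl tick (s0, fun=> 0%N) u.

Definition query (w : nat -> word) (sc : S * (nat -> nat)) : letter :=
  w (active sc.1) (sc.2 (active sc.1)).

Fixpoint reading (w : nat -> word) (n : nat) : seq letter :=
  if n is n'.+1 then rcons (reading w n') (query w (after (reading w n')))
  else [::].

Definition run (w : nat -> word) (n : nat) : S * (nat -> nat) :=
  after (reading w n).

Lemma after_rcons u a : after (rcons u a) = tick (after u) a.
Proof. exact: foldl_rcons. Qed.

Lemma runS w n : run w n.+1 = tick (run w n) (query w (run w n)).
Proof. by rewrite /run /= after_rcons. Qed.

Lemma size_reading w n : size (reading w n) = n.
Proof. by elim: n => //= n IH; rewrite size_rcons IH. Qed.

(** What has been read determines all the letters at the places that have been
    read. *)
Lemma reading_agree w w' n : reading w n = reading w' n ->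
  forall j k, (k < (run w n).2 j)%N -> w j k = w' j k.
Proof.
elim: n => //= n IH /rcons_inj[/[dup] e /IH {}IH].
rewrite -e => q j k; rewrite runS /=; case: eqP => [->|_]; last exact: IH.
by rewrite ltnS leq_eqVlt => /orP[/eqP ->|/IH].
Qed.

Lemma run_counts w n : exists M, (forall j, (M <= j)%N -> (run w n).2 j = 0%N) /\
  (\sum_(j <- iota 0 M) (run w n).2 j = n)%N.
Proof.
elim: n => [|n [M [h0 hs]]]; first by exists 0%N; split=> //; rewrite big_nil.
rewrite runS; set i := active (run w n).1.
pose M' := maxn M i.+1; exists M'; split=> [j hj /=|/=].
  by rewrite h0 ?ifF //; move: hj; rewrite /M' /i; lia.
have hi : i \in iota 0 M' by rewrite mem_iota /M'; lia.
have hs' : (\sum_(j <- iota 0 M') (run w n).2 j = n)%N.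
  have -> : M' = (M + (M' - M))%N by rewrite /M'; lia.
  rewrite iotaD big_cat /= hs big1_seq ?addn0 // => j /=.
  by rewrite mem_iota => hj; apply: h0; lia.
rewrite (bigD1_seq i) ?iota_uniq //= -/i eqxx addSn -[in RHS]hs'; congr _.+1.
rewrite [RHS](bigD1_seq i) ?iota_uniq //=; congr addn.
by apply: eq_bigr => j /negbTE; rewrite -/i => ->.
Qed.

Section Measure.
Variables (R : realType) (d : measure_display) (T : measurableType d).
Variables (P : probability T R) (W : nat -> nat -> {RV P >-> letter}).
Hypothesis hW : forall i : nat, simple_random_walk (W i).
Hypothesis hind : independent P (fun i : nat => word_sigma_algebra (W i)).

Let words (t : T) : nat -> word := fun i n => W i n t.

Lemma letter_preimage i n (a : letter) :
  g_sigma_algebra_preimage (W i n) [set t | W i n t = a].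
Proof. by exists [set a] => //; rewrite setTI. Qed.

Lemma measurable_letter i n (a : letter) : measurable [set t | W i n t = a].
Proof.
by have := @measurable_funPT _ _ _ _ (W i n) measurableT [set a] I; rewrite setTI.
Qed.

Lemma prob_letter i n (a : letter) : P [set t | W i n t = a] = ((4^-1)%:E)%E.
Proof. by have [_ /(_ n a)] := hW i. Qed.

Lemma prob_prefix i c (f : word) :
  P (\bigcap_(n in `I_c) [set t | W i n t = f n]) = ((4^-1) ^+ c)%:E.
Proof.
have [ind _] := hW i; rewrite (independent_prefix ind) => [|n _]; last first.
  exact: letter_preimage.
under eq_bigr do rewrite prob_letter.
rewrite -[in RHS](size_iota 0 c); elim: (iota 0 c) => [|m s IH].
  by rewrite big_nil.
by rewrite big_cons IH exprS EFinM.
Qed.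

Lemma prefix_word_sigma_algebra i c (f : word) :
  word_sigma_algebra (W i) (\bigcap_(n in `I_c) [set t | W i n t = f n]).
Proof.
set G := \bigcup_n g_sigma_algebra_preimage (W i n).
have := @fin_bigcap_measurable _ (g_sigma_algebraType G) nat `I_c
  (fun n => [set t | W i n t = f n]) (finite_II c).
apply=> n _; apply: sub_gen_smallest; exists n => //; exact: letter_preimage.
Qed.

Lemma prob_prefixes M (c : nat -> nat) (f : nat -> word) :
  P (\bigcap_(i in `I_M) \bigcap_(n in `I_(c i)) [set t | W i n t = f i n])
    = ((4^-1) ^+ (\sum_(i <- iota 0 M) c i))%:E.
Proof.
rewrite (independent_prefix hind) => [|i _]; last exact: prefix_word_sigma_algebra.
rewrite (eq_bigr (fun i => ((4^-1) ^+ c i)%:E)) => [|i _]; last exact: prob_prefix.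
elim: (iota 0 M) => [|i s IH]; first by rewrite !big_nil.
by rewrite !big_cons IH exprD EFinM.
Qed.

Lemma measurable_reading n u : measurable [set t | reading (words t) n = u].
Proof.
elim: n u => [|n IH] u /=.
  have [->|/eqP ne] := eqVneq u [::].
    by rewrite (_ : [set _ | _] = setT) //; apply/seteqP.
  by rewrite (_ : [set _ | _] = set0) //; apply/seteqP; split=> // t /= /esym.
case/lastP: u => [|u a].
  rewrite (_ : [set _ | _] = set0) //; apply/seteqP; split=> // t /=.
  by case: (reading _ _).
rewrite (_ : [set _ | _] = [set t | reading (words t) n = u] `&`
   [set t | W (active (after u).1) ((after u).2 (active (after u).1)) t = a]).
  exact: measurableI (IH u) (measurable_letter _ _ _).
apply/seteqP; split=> t /=; first by move=> /rcons_inj[<- <-]; split.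
by move=> [e1 e2]; rewrite e1 /query -e2.
Qed.

(** By [reading_agree] the event prescribes the value of [n] letters, whose
    places are the first [(run w n).2 j] places of each word [j]. *)
Lemma prob_reading n u :
  (P [set t | reading (words t) n = u] <= ((4^-1) ^+ n)%:E)%E.
Proof.
have [->|/set0P[t0 /= et0]] := eqVneq [set t | reading (words t) n = u] set0.
  by rewrite measure0 lee_fin exprn_ge0.
have [M [_ hM]] := run_counts (words t0) n.
rewrite -[in X in (_ <= X)%E]hM -(prob_prefixes M _ (words t0)).
apply: le_measure; rewrite ?inE.
- exact: measurable_reading.
- apply: bigcap_measurableType => i _; apply: bigcap_measurableType => k _.
  exact: measurable_letter.
- move=> t /= et i _ k /= hk; symmetry.
  by apply: (@reading_agree (words t0) (words t) n) => //; rewrite et0 et.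
Qed.

Variables (valid : S -> Prop) (gauge : S -> R).
Hypothesis valid0 : valid s0.
Hypothesis valid_upd : forall s a, valid s -> valid (upd s a).
Hypothesis gauge_ge0 : forall s, valid s -> 0 <= gauge s.
Hypothesis gauge_upd : forall s, valid s -> \sum_a gauge (upd s a) <= gauge s *+ 4.
Hypothesis stop : forall s a, 1 <= gauge s -> upd s a = s.

Lemma valid_after u : valid (after u).1.
Proof.
by elim/last_ind: u => [|u a IH] //; rewrite after_rcons; apply: valid_upd.
Qed.

Let high n := [set t | 1 <= gauge (run (words t) n).1].

Fixpoint all_words (n : nat) : seq (seq letter) :=
  if n is n'.+1 then [seq rcons u a | u <- all_words n', a <- index_enum letter]
  else [:: [::]].

Lemma mem_all_words u : u \in all_words (size u).
Proof.
elim/last_ind: u => [|u a IH] //; rewrite size_rcons /=.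
by apply/allpairsP; exists (u, a); split; rewrite //= mem_index_enum.
Qed.

Lemma high_bigcup n : high n = \big[setU/set0]_(u <- all_words n |
   1 <= gauge (after u).1) [set t | reading (words t) n = u].
Proof.
rewrite -bigcup_seq_cond; apply/seteqP; split=> t /=.
  move=> h; exists (reading (words t) n) => //=; apply/andP; split=> //.
  by rewrite -[X in all_words X](size_reading (words t) n) mem_all_words.
by move=> [u /= /andP[_ h] e]; rewrite /high /run /= e.
Qed.

Lemma measurable_high n : measurable (high n).
Proof.
by rewrite high_bigcup; apply: bigsetU_measurable => u _; apply: measurable_reading.
Qed.

Lemma sum_gauge n : \sum_(u <- all_words n) gauge (after u).1 <= gauge s0 * 4 ^+ n.
Proof.
elim: n => [|n IH]; first by rewrite /= big_seq1 mulr1.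
rewrite /= big_allpairs_dep exprSr mulrA mulr_natr.
apply: (@le_trans _ _ (\sum_(u <- all_words n) gauge (after u).1 *+ 4)).
  apply: ler_sum => u _; under eq_bigr do rewrite after_rcons.
  exact/gauge_upd/valid_after.
by rewrite sumrMnl lerMn2r IH orbT.
Qed.

(** Markov's inequality for the supermartingale: each of the [4 ^ n] possible
    readings has probability at most [4 ^- n]. *)
Lemma prob_high n : (P (high n) <= (gauge s0)%:E)%E.
Proof.
rewrite high_bigcup.
apply: (@le_trans _ _ (\sum_(u <- all_words n | (1 <= gauge (after u).1)%R)
    ((4^-1) ^+ n * gauge (after u).1)%:E)%E).
  elim: (all_words n) => [|u s IH]; first by rewrite !big_nil measure0.
  rewrite !big_cons; case: ifP => // h.
  have mU : measurable (\big[setU/set0]_(j <- s | 1 <= gauge (after j).1)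
      [set t | reading (words t) n = j]).
    by apply: bigsetU_measurable => v _; apply: measurable_reading.
  apply: (le_trans (measureU2 _ (measurable_reading n u) mU)).
  apply: leeD => //; apply: (le_trans (prob_reading n u)).
  by rewrite lee_fin ler_peMr // exprn_ge0.
rewrite sumEFin lee_fin -mulr_sumr.
apply: (@le_trans _ _ ((4^-1) ^+ n * (gauge s0 * 4 ^+ n))).
  rewrite ler_wpM2l ?exprn_ge0 //; apply: le_trans (sum_gauge n).
  rewrite big_mkcond; apply: ler_sum => u _; case: ifP => // _.
  exact/gauge_ge0/valid_after.
by rewrite mulrCA -exprMn mulVf // expr1n mulr1.
Qed.

Lemma prob_ever_high : (P (\bigcup_n high n) <= (gauge s0)%:E)%E.
Proof.
have nd : nondecreasing_seq high.
  apply/nondecreasing_seqP => n; apply/subsetPset => t /= h.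
  by rewrite /high /= runS /tick /= stop.
have := @nondecreasing_cvg_mu _ _ _ P high measurable_high
  (bigcupT_measurable _ measurable_high) nd.
move=> cv; apply: (cvge_le _ cv) ; apply: nearW => n; exact: prob_high.
Qed.

End Measure.
End ReadOnce.

(** * The limit graph *)
Lemma edge_sym l u v : edge l u v = edge l v u.
Proof. by rewrite /edge orbC. Qed.

Lemma up_step_lattice p c : up_step p c -> lattice_edge p c /\ lattice_edge c p.
Proof.
by case: p => x y /orP[] /eqP ->; split; apply/eqP; rewrite /=; ring.
Qed.

Lemma edge_lattice l u v : wf l -> edge l u v -> lattice_edge u v.
Proof. by move=> w /orP[] /(wf_up w)/up_step_lattice[]. Qed.

Lemma verts_path l v : wf l -> v \in verts l ->
  exists p, path (edge l) origin p /\ last origin p = v.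
Proof.
move=> w; move: v; apply: (tpath_ind w); first by exists [::].
move=> c p h [q [pq lq]]; exists (rcons q c).
by rewrite rcons_path pq lq last_rcons /edge h orbT.
Qed.

(** Only the tips of the other walkers, the top of the trunk and the ends of
    the teeth ever receive new edges.  The next stage attaches its extension to
    one of them, and turns no other old vertex into such a site. *)
Section OpenSites.
Variables (K s w : nat) (l : tree) (row : nat -> nat) (pos : nat -> site).
Hypothesis rdy : ready K s w l row pos.
Let ws : (w <= s)%N := ready_le rdy.
Variable (j : nat).
Hypothesis hj : (j < teeth K s)%N.

Let ext := extension K s w (row w).
Let row' w' := if w' == w then (lo K s.+1 w + j)%N else row w'.
Let s' := (next_stage s w).1.
Let w'' := (next_stage s w).2.

Let end_open : pt (column K s.+1) (lo K s.+1 w + j) \in ends K s w.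
Proof. by apply/mapP; exists j => //; rewrite mem_iota. Qed.

Let tip_open v : (v < s)%N -> v != w -> tip K s w row v \in foreign K s w row.
Proof.
move=> vs vw; rewrite inE; apply/orP; right; apply/mapP; exists v => //.
by rewrite mem_filter vw mem_iota.
Qed.

Lemma base_was_open : base K s' w'' (row' w'') \in foreign K s w row ++ ends K s w.
Proof.
rewrite mem_cat /base /s' /w'' /next_stage; case: (ltnP w s) => h /=.
  case: eqP => [e|ne]; first by rewrite inE /trunk_top ifF ?eqxx //; lia.
  have := @tip_open w.+1; rewrite /tip /level /row' ifF ?ifF; try lia.
  by move=> -> //; lia.
rewrite /row'; case: eqP => [e|/eqP ne]; first by rewrite end_open orbT.
have := @tip_open 0; rewrite /tip /level ifT; last lia.
by move=> -> //; lia.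
Qed.

Lemma foreign_next_open v : v \in foreign K s' w'' row' ->
  v \in verts (grow l ext) -> v \in foreign K s w row ++ ends K s w.
Proof.
rewrite mem_cat inE => /orP[/eqP ->|/mapP[v']].
  rewrite /trunk_top; case: eqP => [e|ne].
    move=> /(territory_extend rdy).
    case=> [[y hy /pt_inj[_ ey]]|[w1 [x [y [/pt_inj[<- _] /lane_pos //]]]]].
    by have := @anchor_incr K _ _ (ltnSn s'); rewrite -/s' in hy; lia.
  move=> _; rewrite inE /trunk_top; apply/orP; left; apply/orP; left.
  move: ne; rewrite /s' /w'' /next_stage; case: (ltnP w s) => h /= ne.
    by rewrite ifF ?eqxx //; lia.
  by rewrite ifT ?eqxx //; lia.
rewrite mem_filter mem_iota => /andP[ne hv'] -> _.
rewrite (tip_next rdy hj) //; case: eqP => [_|/eqP nw].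
  by rewrite end_open orbT.
rewrite tip_open //; move: hv' nw; rewrite /s' /next_stage.
by case: (ltnP w s) => h /=; lia.
Qed.

End OpenSites.

Section Deterministic.
Variables (K : nat) (R : realType) (words : nat -> word).
Local Notation move := (move K).
Local Notation lost := (lost K R).
Local Notation valid := (valid K).
Local Notation st n := (run cur (advance K R) (state0 K) words n).1.
Local Notation cnt n := (run cur (advance K R) (state0 K) words n).2.

Hypothesis never_lost : forall n, ~~ lost (st n).

(** A vertex whose neighbourhood will never change ([closed_forever]). *)
Definition closed (x : state) (v : site) : Prop :=
  v \in verts (tr x) /\
  v \notin foreign K (lvl x) (cur x) (row x) ++ ends K (lvl x) (cur x).

Lemma valid_wf x : valid x -> wf (tr x).
Proof. by case=> l0 [pos0 [rdy -> _ _ _]]; apply: wf_extend rdy. Qed.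

Lemma closed_move x a v : valid x -> closed x v ->
  closed (move x a) v /\ forall u, edge (tr (move x a)) v u = edge (tr x) v u.
Proof.
move=> vld [vV vo]; rewrite /move; case: ifP => [ve|_]; last by split.
have [l0 [pos0 [rdy e off inV out]]] := vld.
case/mapP: ve => j; rewrite mem_iota => hj ->.
have := ready_next rdy (j := j) hj; rewrite -e => rdy'.
set s := lvl x in vo rdy e hj out rdy' *.
set w := cur x in vo rdy e off inV hj out rdy' *.
set row' : nat -> nat := set_at _ _ _.
have fr c : c \in unzip1 (extension K (next_stage s w).1 (next_stage s w).2
    (row' (next_stage s w).2)) -> c != v.
  by move=> h; apply: contraTneq (fresh_child rdy' h) => ->; rewrite vV.
split.
  split; first by rewrite /= verts_extend vV orbT.
  rewrite mem_cat negb_or; apply/andP; split.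
    apply: contra vo => h; apply: (foreign_next_open rdy hj h).
    by rewrite -e.
  by apply/negP => h; have := fr _ (ends_child rdy' h); rewrite eqxx.
move=> u; rewrite /edge /= !mem_grow.
have -> : (v, u) \in extension K (next_stage s w).1 (next_stage s w).2
    (row' (next_stage s w).2) = false.
  apply/negP => h; have : v != v by apply: fr; apply/mapP; exists (v, u).
  by rewrite eqxx.
have -> // : (u, v) \in extension K (next_stage s w).1 (next_stage s w).2
    (row' (next_stage s w).2) = false.
apply/negP => h; move: vo; rewrite (parent_base rdy' h vV).
by rewrite (base_was_open rdy hj).
Qed.

Lemma valid_run n : valid (st n).
Proof. by apply: valid_after; [exact: valid0|exact: valid_advance]. Qed.

Lemma stS n : st n.+1 = move (st n) (words (cur (st n)) (cnt n (cur (st n)))).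
Proof. by rewrite runS /= /advance (negbTE (never_lost n)). Qed.

Lemma cntS n i : cnt n.+1 i = if i == cur (st n) then (cnt n i).+1 else cnt n i.
Proof. by rewrite runS. Qed.

(** The end of a tooth would finish the stage, and at a foreign site the risk
    is at least 1. *)
Lemma active_closed n : closed (st n) (pos (st n) (cur (st n))).
Proof.
have vld := valid_run n; have [l0 [pos0 [rdy e off inV out]]] := vld.
split=> //; rewrite mem_cat negb_or out andbT; apply/negP => /(risk_foreign R rdy).
by rewrite leNgt -e => /negP; apply; apply: (not_lost_risk vld).
Qed.

Lemma closed_forever n m v : (n <= m)%N -> closed (st n) v ->
  closed (st m) v /\ forall u, edge (tr (st m)) v u = edge (tr (st n)) v u.
Proof.
move=> nm cl; elim: m nm => [|m IH]; first by rewrite leqn0 => /eqP <-.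
rewrite leq_eqVlt ltnS => /orP[/eqP <-//|/IH[cm em]].
pose a := words (cur (st m)) (cnt m (cur (st m))).
have [cS eS] := closed_move a (valid_run m) cm.
by rewrite stS; split=> // u; rewrite eS em.
Qed.

Definition limit_graph : rel site :=
  fun u v => `[< exists n, edge (tr (st n)) u v >].

Lemma limit_graph_closed n v u : closed (st n) v ->
  limit_graph v u = edge (tr (st n)) v u.
Proof.
move=> cl; apply/asboolP/idP => [[m hm]|h]; last by exists n.
have [nm|/ltnW mn] := leqP n m.
  by have [_ <-] := closed_forever nm cl.
elim: n mn {cl} => [|n IH]; first by rewrite leqn0 => /eqP <-.
rewrite leq_eqVlt ltnS => /orP[/eqP <-//|/IH {}IH].
rewrite stS /move; case: ifP => //= _; rewrite /edge !mem_grow.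
by move/orP: IH => [] ->; rewrite !orbT.
Qed.

(** The moving walker stands on a closed vertex, so that the tree of the moment
    and the limit graph answer its query in the same way. *)
Lemma walk_run n i : induced_walk (words i) limit_graph (cnt n i) = pos (st n) i.
Proof.
elim: n => [|n IH] //=; rewrite cntS stS.
have pe : pos (move (st n) (words (cur (st n)) (cnt n (cur (st n))))) =
  set_at (pos (st n)) (cur (st n)) (step (tr (st n)) (pos (st n) (cur (st n)))
    (words (cur (st n)) (cnt n (cur (st n))))).
  by rewrite /move; case: ifP.
rewrite pe /set_at; case: eqP IH => [-> IH|//]; rewrite /= IH.
by rewrite (limit_graph_closed _ (active_closed n)).
Qed.

(** Within a stage the clock increases with each letter, while the tree, hence
    the time allotted to the stage, does not change. *)
Lemma leave_stage n : exists2 m, (n < m)%N &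
  lvl (st m) = (next_stage (lvl (st n)) (cur (st n))).1 /\
  cur (st m) = (next_stage (lvl (st n)) (cur (st n))).2.
Proof.
move e : (patience K (lvl (st n)) (tr (st n)) - clock (st n))%N => k.
elim: k n e => [|k IH] n e.
  have := clock_bound (valid_run n) (never_lost n); lia.
pose b := step (tr (st n)) (pos (st n) (cur (st n)))
  (words (cur (st n)) (cnt n (cur (st n)))).
have [be|be] := boolP (b \in ends K (lvl (st n)) (cur (st n))).
  by exists n.+1; rewrite // stS /move ifT.
have eS : st n.+1 = State (lvl (st n)) (cur (st n)) (tr (st n)) (row (st n))
    (set_at (pos (st n)) (cur (st n)) b) (clock (st n)).+1.
  by rewrite stS /move ifF // (negbTE be).
have [|m nm] := IH n.+1; first by rewrite eS /=; lia.
by rewrite eS /= => h; exists m => //; apply: ltnW.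
Qed.

Lemma reach_stage s w : (w <= s)%N ->
  exists n, lvl (st n) = s /\ cur (st n) = w.
Proof.
have stepw s' w' n : (w' < s')%N -> lvl (st n) = s' -> cur (st n) = w' ->
    exists n', lvl (st n') = s' /\ cur (st n') = w'.+1.
  move=> h e1 e2; have [m _] := leave_stage n.
  by rewrite e1 e2 /next_stage h => ?; exists m.
have row_ s' n : lvl (st n) = s' -> cur (st n) = 0%N ->
    forall w', (w' <= s')%N -> exists n', lvl (st n') = s' /\ cur (st n') = w'.
  move=> e1 e2; elim=> [|w' IH] hw; first by exists n.
  by have [n' [h1 h2]] := IH (ltnW hw); apply: (stepw _ _ n').
suff [n [e1 e2]] : exists n, lvl (st n) = s /\ cur (st n) = 0%N.
  exact: row_ e1 e2 _.
elim: s {w} => [|s [n [e1 e2]]]; first by exists 0%N.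
have [n' [h1 h2]] := row_ _ _ e1 e2 _ (leqnn s).
have [m _] := leave_stage n'; rewrite h1 h2 /next_stage ltnn => ?; by exists m.
Qed.

Lemma lvl_mono n m : (n <= m)%N -> (lvl (st n) <= lvl (st m))%N.
Proof.
elim: m => [|m IH]; first by rewrite leqn0 => /eqP <-.
rewrite leq_eqVlt ltnS => /orP[/eqP <-//|/IH h]; apply: leq_trans h _.
by rewrite stS /move; case: ifP => //= _; rewrite /next_stage; case: ifP => //=.
Qed.

Lemma cnt_mono n m i : (n <= m)%N -> (cnt n i <= cnt m i)%N.
Proof.
elim: m => [|m IH]; first by rewrite leqn0 => /eqP <-.
rewrite leq_eqVlt ltnS => /orP[/eqP <-//|/IH h]; apply: leq_trans h _.
by rewrite cntS; case: ifP.
Qed.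

(** Until the next turn of walker [i] no letter of its word is read. *)
Lemma next_turn n i : exists2 m, cur (st m) = i & cnt m i = cnt n i.
Proof.
have ex : exists m, (n <= m)%N && (cur (st m) == i).
  have [m [h1 h2]] := reach_stage (leq_maxl i (lvl (st n)).+1).
  exists m; rewrite h2 eqxx andbT leqNgt; apply/negP => /ltnW/lvl_mono.
  by rewrite h1; lia.
case: (ex_minnP ex) => m /andP[nm /eqP cm] mn; exists m => //.
have : forall k, (n <= k <= m)%N -> cnt k i = cnt n i; last first.
  by apply; rewrite nm leqnn.
elim=> [|k IH] hk; first by have -> : n = 0%N by lia.
have [<-//|ne] := eqVneq n k.+1.
rewrite cntS IH ?ifF //; last lia.
by apply/negP => /eqP e; have := mn k; rewrite -e eqxx; lia.
Qed.

Lemma every_letter k i : exists2 n, cur (st n) = i & cnt n i = k.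
Proof.
elim: k => [|k [n h1 h2]]; first exact: next_turn 0%N i.
by have [m e1 e2] := next_turn n.+1 i; exists m => //; rewrite e2 cntS h1 eqxx h2.
Qed.

Lemma visit_time k i v : induced_walk (words i) limit_graph k = v ->
  exists n, [/\ cur (st n) = i, cnt n i = k & pos (st n) i = v].
Proof.
move=> h; have [n h1 h2] := every_letter k i.
by exists n; split=> //; rewrite -walk_run h2.
Qed.

Lemma spanning_limit : spanning_subgraph limit_graph.
Proof.
split=> [u v|u v /asboolP[n]].
  by apply/asbool_equiv_eq; split=> -[n h]; exists n; rewrite edge_sym.
exact: edge_lattice (valid_wf (valid_run n)).
Qed.

Lemma leq_anchor s : (s <= anchor K s)%N.
Proof.
elim: s => // s IH; apply: leq_ltn_trans IH _; exact: anchor_incr.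
Qed.

(** At a level [s] larger than [i] and than the depth of [v], the site [v] lies
    behind half of the way to the tip, where the risk is at least 1.  So all
    the visits to [v] occur before such a level is reached. *)
Lemma finite_visits i v : finite_set (visits (words i) limit_graph v).
Proof.
pose D := maxn i.+1 (absz (v.1 + v.2 + 1)).
have [N [hN _]] := reach_stage (leq0n D).
apply: (@sub_finite_set _ _ `I_(cnt N i)); last exact: finite_II.
move=> k /= /visit_time[n [h1 h2 h3]].
have nN : (n < N)%N.
  rewrite ltnNge; apply/negP => /lvl_mono; rewrite hN => hl.
  have vld := valid_run n; have [l0 [pos0 [rdy e off inV out]]] := vld.
  have := not_lost_risk vld (never_lost n); apply/negP; rewrite -leNgt h1 h3.
  have wl := valid_wf vld; rewrite h1 h3 in inV.
  have hD := leq_anchor (lvl (st n)).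
  rewrite h1 in rdy e; rewrite e; apply: (risk_low R rdy); rewrite -?e //.
    exact: leq_trans (leq_maxl _ _) hl.
  have -> : size (tpath (tr (st n)) v) = absz (v.1 + v.2 + 1).
    by rewrite -(size_tpath wl inV).
  apply: leq_trans (leq_maxr _ _) (leq_trans hl _).
  by apply: leq_trans hD _; rewrite leq_pmull.
by have := cnt_mono i nN; rewrite cntS h1 eqxx h2.
Qed.

(** When walker [i] makes its first stage, the root of the lane [q >= i + 2] is
    not yet in the tree; later the whole trunk is too far behind its tip. *)
Lemma infinitely_many_missed i : infinite_set
  [set v | reachable limit_graph v /\ visits (words i) limit_graph v = set0].
Proof.
pose z q := pt 0 (anchor K (q + i + 2)).
have zI : injective z.
  move=> q q' /pt_inj[_ e]; case: (ltngtP q q') => // h.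
    by have := @anchor_incr K (q + i + 2) (q' + i + 2); rewrite e ltnn; lia.
  by have := @anchor_incr K (q' + i + 2) (q + i + 2); rewrite e ltnn; lia.
suff sub : range z `<=`
    [set v | reachable limit_graph v /\ visits (words i) limit_graph v = set0].
  move/(sub_finite_set sub)/(finite_preimage (f := z)).
  move=> /(_ (fun x y _ _ => @zI x y)).
  rewrite (_ : z @^-1` range z = setT); first exact: infinite_nat.
  by apply/seteqP; split=> // q _; exists q.
move=> _ [q _ <-]; split.
  have [n [e1 e2]] := reach_stage (leq0n (q + i + 2)).
  have vld := valid_run n; have [l0 [pos0 [rdy e off inV out]]] := vld.
  have wl := valid_wf vld.
  have zV : z q \in verts (tr (st n)).
    by have := ready_trunk rdy; rewrite e verts_extend e1 => ->; rewrite orbT.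
  have [p [pp lp]] := verts_path wl zV; exists p; split=> //.
  by apply: sub_path pp => u v h; apply/asboolP; exists n.
apply/seteqP; split=> // k /= /visit_time[n [h1 h2 h3]].
have vld := valid_run n; have [l0 [pos0 [rdy e off inV out]]] := vld.
rewrite h1 h3 e h1 in inV; rewrite h1 in rdy e.
have := ready_le rdy; rewrite leq_eqVlt => /orP[/eqP es|sw].
  have := territory_extend rdy inV.
  case=> [[y hy /pt_inj[_ ey]]|[w1 [x [y [/pt_inj[<- _] /lane_pos //]]]]].
  move: hy; rewrite /next_stage -es ltnn /= -ey leqNgt => /negP; apply.
  by apply: anchor_incr; lia.
have := not_lost_risk vld (never_lost n); apply/negP.
by rewrite -leNgt h1 h3 e; apply: (risk_trunk R rdy).
Qed.

End Deterministic.

Lemma valid_gauge_ge0 K (R : realType) st : valid K st -> 0 <= gauge K R st.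
Proof.
move=> vld; have [l0 [pos0 [_ _ _ inV _]]] := vld.
apply: addr_ge0; [apply: addr_ge0|exact: reserve_ge0]; last exact: delay_ge0.
exact: (valid_risk_ge0 R vld).
Qed.

Definition ever_lost K (R : realType) (words : nat -> word) : Prop :=
  exists n, lost K R (run cur (advance K R) (state0 K) words n).1.

Lemma prob_ever_lost (R : realType) (d : measure_display) (T : measurableType d)
    (P : probability T R) (W : nat -> nat -> {RV P >-> letter}) K :
  (forall i, simple_random_walk (W i)) ->
  independent P (fun i => word_sigma_algebra (W i)) ->
  let B := [set t | ever_lost K R (fun i n => W i n t)] in
  measurable B /\ (P B <= (3 / (2 ^ K)%:R)%:E)%E.
Proof.
move=> hW hind B.
have stop st a : 1 <= gauge K R st -> advance K R st a = st.
  by move=> h; rewrite /advance /lost h.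
have -> : B = \bigcup_n [set t | 1 <= gauge K R
    (run cur (advance K R) (state0 K) (fun i n => W i n t) n).1].
  by apply/seteqP; split=> t [n h]; exists n.
have vS := @valid_advance K R; have v0 := valid0 K.
split.
  apply: bigcupT_measurable => n; exact: measurable_high.
apply: (@le_trans _ _ (gauge K R (state0 K))%:E); last by rewrite lee_fin gauge0.
exact: (prob_ever_high cur hW hind v0 vS
  (@valid_gauge_ge0 K R) (@gauge_drift K R) stop).
Qed.

Unset Implicit Arguments.

Theorem theorem1p2 (R : realType) (d : measure_display) (T : measurableType d)
    (P : probability T R) (W : nat -> nat -> {RV P >-> letter})
    (hW : forall i : nat, simple_random_walk (W i))
    (hind : independent P (fun i : nat => word_sigma_algebra (W i))) :
  {ae P, forall t : T, exists H : rel site,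
    spanning_subgraph H /\
    forall i : nat,
      let w : word := fun n => W i n t in
      (forall v : site, reachable H v -> finite_set (visits w H v)) /\
      infinite_set [set v : site | reachable H v /\ visits w H v = set0]}.
Proof.
pose B K := [set t | ever_lost K R (fun i n => W i n t)].
have mB K : measurable (B K) by have [] := @prob_ever_lost _ _ _ _ W K hW hind.
have PB K : (P (B K) <= (3 / (2 ^ K)%:R)%:E)%E.
  by have [] := @prob_ever_lost _ _ _ _ W K hW hind.
(* The exceptional set has measure at most [3 / 2 ^ K] for all [K]. *)
exists (\bigcap_K B K); split; first exact: bigcapT_measurable.
  apply/eqP; rewrite eq_le measure_ge0 andbT; apply/lee_addgt0Pr => e e0.
  rewrite add0e; pose K := Num.bound (3 / e).
  have K0 : 0 < (2 ^ K)%:R :> R by rewrite ltr0n expn_gt0.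
  apply: (@le_trans _ _ (P (B K))).
    apply: le_measure; rewrite ?inE //; first exact: bigcapT_measurable.
    exact: bigcap_inf.
  apply: (le_trans (PB K)); rewrite lee_fin ler_pdivrMr // mulrC -ler_pdivrMr //.
  apply: (@le_trans _ _ K%:R); last by rewrite ler_nat ltnW // ltn_expl.
  by apply/ltW/archi_boundP; rewrite divr_ge0 // ltW.
move=> t /= bad K _; apply: contrapT => nb; apply: bad.
pose words i n := W i n t.
have nl n : ~~ lost K R (run cur (advance K R) (state0 K) words n).1.
  by apply/negP => h; apply: nb; exists n.
exists (limit_graph K R words); split; first exact: spanning_limit.
move=> i; split=> [v _|]; first exact: finite_visits.
exact: infinitely_many_missed.
Qed.
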